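(* Let $n\ge 3$ and let $\beta,\gamma$ be braids in the dual braid monoid $B_n^{+*}$. Let $(\beta_b,\dots,\beta_1)$ be the $\phi_n$-splitting of $\beta$ and $(\gamma_c,\dots,\gamma_1)$ the $\phi_n$-splitting of $\gamma$. Then $\beta<\gamma$ holds if and only if $(\beta_b,\dots,\beta_1)$ is smaller than $(\gamma_c,\dots,\gamma_1)$ with respect to the $\mathtt{ShortLex}$-extension of the ordering $<$ of $B_{n-1}^{+*}$, i.e., if and only if either $b<c$, or $b=c$ and there exists $t\in\{1,\dots,b\}$ such that $\beta_t<\gamma_t$ holds and $\beta_k=\gamma_k$ holds for all $k$ with $b\ge k>t$.
   Context: **Braids and the ordering.** $B_n$ ($n\ge 2$) is Artin's braid group with generators $\sigma_1,\dots,\sigma_{n-1}$ and relations $\sigma_i\sigma_j=\sigma_j\sigma_i$ for $|i-j|\ge2$, $\sigma_i\sigma_j\sigma_i=\sigma_j\sigma_i\sigma_j$ for $|i-j|=1$; $B_{m}$ is viewed as a subgroup of $B_n$ for $m\le n$ via $\sigma_i\mapsto\sigma_i$. A word in the letters $\sigma_j^{\pm1}$ is $\sigma_i$-positive (resp. $\sigma_i$-negative) if it contains at least one letter $\sigma_i$ (resp. $\sigma_i^{-1}$), no letter $\sigma_i^{-1}$ (resp. $\sigma_i$), and no letter $\sigma_j^{\pm1}$ with $j>i$. A braid is $\sigma_i$-positive (resp. $\sigma_i$-negative) if at least one word representing it is; it is $\sigma$-positive (resp. $\sigma$-negative) if it is $\sigma_i$-positive (resp. $\sigma_i$-negative) for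 some $i$. For braids $\beta,\gamma$, $\beta<\gamma$ means that $\beta^{-1}\gamma$ is $\sigma$-positive (the Dehornoy ordering). **Dual braid monoid.** For $1\le p<q$, $a_{p,q}=\sigma_p\cdots\sigma_{q-2}\,\sigma_{q-1}\,\sigma_{q-2}^{-1}\cdots\sigma_p^{-1}$. $B_n^{+*}$ is the submonoid of $B_n$ generated by the $a_{p,q}$ with $1\le p<q\le n$; thus $B_{n-1}^{+*}\subseteq B_n^{+*}$. Put $\delta_n=\sigma_1\sigma_2\cdots\sigma_{n-1}$ and let $\phi_n(\beta)=\delta_n\beta\delta_n^{-1}$, an automorphism of $B_n^{+*}$. **Splitting.** Let $n\ge3$. The $B_{n-1}^{+*}$-tail of $\beta\in B_n^{+*}$ is the maximal right-divisor of $\beta$ (in the monoid $B_n^{+*}$) that lies in $B_{n-1}^{+*}$. For every nontrivial $\beta\in B_n^{+*}$ there is a unique sequence $(\beta_b,\dots,\beta_1)$ of elements of $B_{n-1}^{+*}$ with $\beta_b\ne1$ such that $\beta=\phi_n^{b-1}(\beta_b)\cdots\phi_n(\beta_2)\cdot\beta_1$ and, for each $k\ge1$, the $B_{n-1}^{+*}$-tail of $\phi_n^{b-k}(\beta_b)\cdots\phi_n(\beta_{k+1})$ is trivial. This sequence is the $\phi_n$-splitting of $\beta$. The $\phi_n$-splitting of the trivial braid is the length one sequence $(1)$. *)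

(* Defs.v *)
(* boolp is used only to quotient by an equivalence in Prop. *)
From HB Require Import structures.
From mathcomp Require Import all_boot.
From mathcomp Require Import boolp.

Set Implicit Arguments.
Unset Strict Implicit.
Unset Printing Implicit Defensive.

Local Open Scope group_scope.
Local Open Scope quotient_scope.

(* A letter (i, true) stands for sigma_i, and (i, false) for its inverse. *)
Definition letter (n : nat) : Type := ({i : nat | 0 < i < n} * bool)%type.
Definition word (n : nat) : Type := seq (letter n).

HB.instance Definition _ (n : nat) := Choice.on (word n).

Inductive word_equiv (n : nat) : word n -> word n -> Prop :=
| word_equiv_refl u : word_equiv u u
| word_equiv_sym u v : word_equiv u v -> word_equiv v u
| word_equiv_trans u v w : word_equiv u v -> word_equiv v w -> word_equiv u w
| word_equiv_ctx u v w w' :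
    word_equiv w w' -> word_equiv (u ++ w ++ v) (u ++ w' ++ v)
| word_equiv_cancel i s : word_equiv [:: (i, s); (i, ~~ s)] [::]
| word_equiv_comm i j :
    ((val i).+2 <= val j) || ((val j).+2 <= val i) ->
    word_equiv [:: (i, true); (j, true)] [:: (j, true); (i, true)]
| word_equiv_braid i j :
    (val j == (val i).+1) || (val i == (val j).+1) ->
    word_equiv [:: (i, true); (j, true); (i, true)]
               [:: (j, true); (i, true); (j, true)].

Definition word_equivb (n : nat) : rel (word n) := fun u v => `[< word_equiv u v >].

Lemma word_equivb_refl (n : nat) : reflexive (@word_equivb n).
Proof. by move=> u; apply/asboolP; apply: word_equiv_refl. Qed.

Lemma word_equivb_sym (n : nat) : symmetric (@word_equivb n).
Proof. by move=> u v; apply/asboolP/asboolP => /word_equiv_sym. Qed.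

Lemma word_equivb_trans (n : nat) : transitive (@word_equivb n).
Proof.
move=> v u w /asboolP uv /asboolP vw; apply/asboolP.
exact: word_equiv_trans vw.
Qed.

Canonical word_equiv_rel (n : nat) :=
  EquivRel (@word_equivb n) (@word_equivb_refl n) (@word_equivb_sym n)
    (@word_equivb_trans n).

Definition braid (n : nat) : Type := {eq_quot (@word_equivb n)}.

HB.instance Definition _ (n : nat) := Choice.on (braid n).
HB.instance Definition _ (n : nat) := EqQuotient.on (braid n).

Definition braid_of_word (n : nat) (w : word n) : braid n := \pi_(braid n) w.

Lemma braid_of_wordP (n : nat) (u v : word n) :
  braid_of_word u = braid_of_word v <-> word_equiv u v.
Proof.
split=> [/eqmodP/asboolP //|uv]; apply/eqmodP; exact/asboolP.
Qed.

Lemma braid_of_wordK (n : nat) (x : braid n) : braid_of_word (repr x) = x.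
Proof. exact: reprK. Qed.

Definition word_inv (n : nat) (w : word n) : word n :=
  rev [seq (l.1, ~~ l.2) | l <- w].

Definition braid_one (n : nat) : braid n := braid_of_word [::].
Definition braid_mul (n : nat) (x y : braid n) : braid n :=
  braid_of_word (repr x ++ repr y).
Definition braid_inv (n : nat) (x : braid n) : braid n :=
  braid_of_word (word_inv (repr x)).

Lemma word_equiv_cat (n : nat) (u u' v v' : word n) :
  word_equiv u u' -> word_equiv v v' -> word_equiv (u ++ v) (u' ++ v').
Proof.
move=> uu' vv'; apply: (@word_equiv_trans _ _ (u' ++ v)).
  exact: (@word_equiv_ctx _ [::] v).
by have := @word_equiv_ctx _ u' [::] _ _ vv'; rewrite !cats0.
Qed.

Lemma word_equiv_repr (n : nat) (u : word n) :
  word_equiv (repr (braid_of_word u)) u.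
Proof. by apply/braid_of_wordP; rewrite braid_of_wordK. Qed.

Lemma braid_of_word_cat (n : nat) (u v : word n) :
  braid_of_word (u ++ v) = braid_mul (braid_of_word u) (braid_of_word v).
Proof.
apply/braid_of_wordP/word_equiv_sym.
by apply: word_equiv_cat; apply: word_equiv_repr.
Qed.

Lemma word_inv_cat (n : nat) (u v : word n) :
  word_inv (u ++ v) = word_inv v ++ word_inv u.
Proof. by rewrite /word_inv map_cat rev_cat. Qed.

Lemma word_invK (n : nat) : involutive (@word_inv n).
Proof.
move=> w; rewrite /word_inv map_rev revK -map_comp -[RHS]map_id.
by apply: eq_map => -[i s] /=; rewrite negbK.
Qed.

Lemma word_equiv_catV (n : nat) (u : word n) : word_equiv (u ++ word_inv u) [::].
Proof.
elim: u => [|[i s] u IHu]; first exact: word_equiv_refl.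
rewrite -cat1s word_inv_cat -catA [u ++ _]catA.
apply: word_equiv_trans (word_equiv_cancel i s).
exact: (@word_equiv_ctx _ [:: (i, s)] [:: (i, ~~ s)] _ [::]).
Qed.

Lemma braid_mulA (n : nat) : associative (@braid_mul n).
Proof.
move=> x y z; rewrite -(braid_of_wordK x) -(braid_of_wordK y).
by rewrite -(braid_of_wordK z) -!braid_of_word_cat catA.
Qed.

Lemma braid_1mul (n : nat) : left_id (@braid_one n) (@braid_mul n).
Proof. by move=> x; rewrite -(braid_of_wordK x) -braid_of_word_cat. Qed.

Lemma braid_mul1 (n : nat) : right_id (@braid_one n) (@braid_mul n).
Proof. by move=> x; rewrite -(braid_of_wordK x) -braid_of_word_cat cats0. Qed.

Lemma braid_mulV (n : nat) :
  right_inverse (@braid_one n) (@braid_inv n) (@braid_mul n).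
Proof.
move=> x; rewrite -{1}(braid_of_wordK x) -braid_of_word_cat.
by apply/braid_of_wordP; apply: word_equiv_catV.
Qed.

Lemma braid_Vmul (n : nat) :
  left_inverse (@braid_one n) (@braid_inv n) (@braid_mul n).
Proof.
move=> x; rewrite -{2}(braid_of_wordK x) -braid_of_word_cat.
apply/braid_of_wordP; rewrite -{2}[repr x]word_invK; exact: word_equiv_catV.
Qed.

HB.instance Definition _ (n : nat) :=
  isGroup.Build (braid n) (@braid_mulA n) (@braid_1mul n) (@braid_mul1 n)
    (@braid_Vmul n) (@braid_mulV n).

(* Junk value 1 when i is not in {1, ..., n - 1}. *)
Definition sigma (n i : nat) : braid n :=
  if insub i is Some j then braid_of_word [:: (j, true)] else 1.

Definition word_sigma_positive (n : nat) (i : {i : nat | 0 < i < n})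
    (w : word n) : bool :=
  [&& (i, true) \in w, (i, false) \notin w & all (fun l => val l.1 <= val i) w].

Definition sigma_positive (n : nat) (x : braid n) : Prop :=
  exists (i : {i : nat | 0 < i < n}) (w : word n),
    word_sigma_positive i w /\ braid_of_word w = x.

Definition braid_lt (n : nat) (x y : braid n) : Prop := sigma_positive (x^-1 * y).

Definition band (n p q : nat) : braid n :=
  \prod_(p <= i < q.-1) sigma n i * sigma n q.-1
    * (\prod_(p <= i < q.-1) sigma n i)^-1.

(* For m <= n, dual n m is the monoid B_m^{+*}, seen inside the group B_n. *)
Inductive dual (n m : nat) : braid n -> Prop :=
| dual_one : dual m 1
| dual_band p q : 0 < p -> p < q -> q <= m -> dual m (band n p q)
| dual_mul x y : dual m x -> dual m y -> dual m (x * y).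
Arguments dual n m x : clear implicits.

Definition delta (n : nat) : braid n := \prod_(1 <= i < n) sigma n i.

Definition phi (n : nat) (x : braid n) : braid n := delta n * x * (delta n)^-1.

Definition right_divides (n : nat) (y x : braid n) : Prop :=
  exists2 z, dual n n z & x = z * y.

(* The maximum, for right-divisibility in B_n^{+*}, of the right-divisors of x
   that lie in B_{n-1}^{+*}. *)
Definition is_tail (n : nat) (x t : braid n) : Prop :=
  [/\ dual n n.-1 t, right_divides t x &
      forall y, dual n n.-1 y -> right_divides y x -> right_divides y t].

(* Sequences are written (s_b, ..., s_1): the head is s_b with b = size s, and
   entry s k is s_k for 1 <= k <= b. *)
Definition entry (n : nat) (s : seq (braid n)) (k : nat) : braid n :=
  nth 1 s (size s - k).

(* phi^(b-k) (s_b) ... phi (s_(k+1)) *)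
Definition upper_prod (n : nat) (s : seq (braid n)) (k : nat) : braid n :=
  \prod_(m <- rev (index_iota k.+1 (size s).+1)) iter (m - k) (@phi n) (entry s m).

Definition is_splitting (n : nat) (x : braid n) (s : seq (braid n)) : Prop :=
  (x = 1 /\ s = [:: 1]) \/
  [/\ x <> 1,
      0 < size s,
      forall k, 0 < k <= size s -> dual n n.-1 (entry s k),
      entry s (size s) <> 1 &
      x = \prod_(m <- rev (index_iota 1 (size s).+1))
            iter m.-1 (@phi n) (entry s m)
      /\ forall k, 0 < k < size s -> is_tail (upper_prod s k) 1].

Definition ShortLex (n : nat) (lt : braid n -> braid n -> Prop)
    (s t : seq (braid n)) : Prop :=
  size s < size t \/
  (size s = size t /\
   exists2 r, 0 < r <= size s &
     lt (entry s r) (entry t r) /\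
     forall k, r < k <= size s -> entry s k = entry t k).

(* Main.v *)
(* For n = m + 1, order the cosets of B_m in B_n by letting x B_m < y B_m when x^-1 y has an
   expression containing sigma_m but not sigma_m^-1; this order is invariant under left
   multiplication, and it suffices to compare cosets as soon as two splittings differ above
   their last entry. Conjugation by delta_n turns the coset of sigma_m^-1 into the base coset
   and sends B_m into B_n, so comparing two splittings amounts to comparing products
   beta_b delta^-1 beta_(b-1) delta^-1 ... applied to the base coset, entry by entry.

   A strict inequality between two entries has to survive the lower entries, which can only
   move the larger coset down in a controlled way. This is measured by thresholds: the coset of
   v' e, where v' is the larger entry with its last letter a_(p,m) removed and e ranges over
   the braids on the strands p+1, ..., m. A letter a_(r,s) sends the coset of
   delta_(j,m) = sigma_j ... sigma_(m-1) to one at least that of delta_(r,m) when r < j <= s.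
   Let a_(q,m+1) right-divide the braid to the left of an entry v, and follow the index j from
   m along the letters of v, read from the right. It ends below q: otherwise no letter of v
   would cross the chord (q, m+1), and a_(q,m+1) could be pushed through v to the right,
   against the triviality of the tails.

   The converse implication and the comparability of the entries follow by induction on n,
   since no sigma-positive braid is trivial: braids act on positive rational sequences by
   a rational version of Dynnikov's formulas, for which a sigma_i-positive braid strictly
   increases a coordinate. *)
Require Import Defs.
From mathcomp Require Import all_boot all_order all_algebra.
From mathcomp Require Import boolp ring zify.

Set Implicit Arguments.
Unset Strict Implicit.
Unset Printing Implicit Defensive.

Import Order.TTheory GRing.Theory Num.Theory.

Local Open Scope group_scope.

(** * Dynnikov's action on positive rational sequences, and nontriviality of sigma-positive
    braids *)

Local Notation state := (nat -> rat * rat).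

(* Dynnikov's formulas with max and + replaced by + and *. The first argument belongs to strand
   j + 1 and the second one to strand j, the reverse of the usual convention, because
   sigma-positivity is decided here by the letter of largest index. *)
Definition dyn_fwd (p q : rat * rat) : (rat * rat) * (rat * rat) :=
  let: (x1, y1) := p in let: (x2, y2) := q in
  let d := (y1 * x2 + x1 * (1 + y1) * (1 + y2))%R in
  ((x1 + y1 * (x1 + x2), y2 * y1 * x2 / d),
   (x1 * x2 * y2 / (x2 + x1 * (1 + y2)), d / x2))%R.

Definition dyn_bwd (p q : rat * rat) : (rat * rat) * (rat * rat) :=
  let: (x1, y1) := p in let: (x2, y2) := q in
  let d := (x1 * y1 + x2 * (1 + y1) * (1 + y2))%R in
  ((x1 * x2 / (x2 + y1 * (x1 + x2)), y2 * x1 * y1 / d),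
   ((x1 + x2 * (1 + y2)) / y2, d / x1))%R.

Definition pos_pair (p : rat * rat) : bool := ((0 < p.1) && (0 < p.2))%R.
Definition pos_state (st : state) : Prop := forall i, pos_pair (st i).

Ltac pos_tac :=
  repeat match goal with
  | |- is_true (Order.lt _ (GRing.add _ _)) => apply: addr_gt0
  | |- is_true (Order.lt _ (GRing.mul _ _)) => apply: mulr_gt0
  | |- is_true (Order.lt _ (GRing.inv _)) => rewrite invr_gt0
  | |- is_true (_ != _) => apply: lt0r_neq0
  end; by [].

Lemma pos_dyn_fwd p q : pos_pair p -> pos_pair q ->
  pos_pair (dyn_fwd p q).1 && pos_pair (dyn_fwd p q).2.
Proof.
case: p q => [x1 y1] [x2 y2] /andP [/= ? ?] /andP [/= ? ?].
by rewrite /pos_pair /=; apply/andP; split; apply/andP; split; pos_tac.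
Qed.

Lemma pos_dyn_bwd p q : pos_pair p -> pos_pair q ->
  pos_pair (dyn_bwd p q).1 && pos_pair (dyn_bwd p q).2.
Proof.
case: p q => [x1 y1] [x2 y2] /andP [/= ? ?] /andP [/= ? ?].
by rewrite /pos_pair /=; apply/andP; split; apply/andP; split; pos_tac.
Qed.

Ltac dyn_field := field; repeat (apply/andP; split); pos_tac.

Lemma dyn_fwdK p q : pos_pair p -> pos_pair q ->
  dyn_bwd (dyn_fwd p q).1 (dyn_fwd p q).2 = (p, q).
Proof.
case: p q => [x1 y1] [x2 y2] /andP [/= ? ?] /andP [/= ? ?].
by rewrite /dyn_fwd /dyn_bwd; congr ((_, _), (_, _)); dyn_field.
Qed.

Lemma dyn_bwdK p q : pos_pair p -> pos_pair q ->
  dyn_fwd (dyn_bwd p q).1 (dyn_bwd p q).2 = (p, q).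
Proof.
case: p q => [x1 y1] [x2 y2] /andP [/= ? ?] /andP [/= ? ?].
by rewrite /dyn_fwd /dyn_bwd; congr ((_, _), (_, _)); dyn_field.
Qed.

Lemma dyn_fwd_braid p q r : pos_pair p -> pos_pair q -> pos_pair r ->
  let hi t := ((dyn_fwd t.1.1 t.1.2).1, (dyn_fwd t.1.1 t.1.2).2, t.2) in
  let lo t := (t.1.1, (dyn_fwd t.1.2 t.2).1, (dyn_fwd t.1.2 t.2).2) in
  hi (lo (hi (p, q, r))) = lo (hi (lo (p, q, r))).
Proof.
case: p q r => [x1 y1] [x2 y2] [x3 y3] /andP [/= ? ?] /andP [/= ? ?] /andP [/= ? ?].
by rewrite /dyn_fwd /=; congr ((_, _), (_, _), (_, _)); dyn_field.
Qed.

Definition dyn_letter (j : nat) (b : bool) (st : state) : state := fun i =>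
  let pq := (if b then dyn_fwd else dyn_bwd) (st j.+1) (st j) in
  if i == j.+1 then pq.1 else if i == j then pq.2 else st i.

Definition dyn_word (n : nat) (w : word n) (st : state) : state :=
  foldr (fun l => dyn_letter (val l.1) l.2) st w.

Lemma pos_dyn_letter j b st : pos_state st -> pos_state (dyn_letter j b st).
Proof.
move=> st0 i; have /andP[h1 h2] : pos_pair (dyn_fwd (st j.+1) (st j)).1 &&
  pos_pair (dyn_fwd (st j.+1) (st j)).2 by exact: pos_dyn_fwd.
have /andP[h3 h4] : pos_pair (dyn_bwd (st j.+1) (st j)).1 &&
  pos_pair (dyn_bwd (st j.+1) (st j)).2 by exact: pos_dyn_bwd.
by rewrite /dyn_letter; case: b; case: ifP => // _; case: ifP.
Qed.

Lemma pos_dyn_word n (w : word n) st : pos_state st -> pos_state (dyn_word w st).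
Proof. by move=> st0; elim: w => //= l w; apply: pos_dyn_letter. Qed.

Lemma dyn_letterK j b st : pos_state st ->
  dyn_letter j b (dyn_letter j (~~ b) st) = st.
Proof.
move=> st0; apply: funext => i; rewrite /dyn_letter /= eqxx (ltn_eqF (ltnSn j)) eqxx.
by case: b => /=; rewrite ?dyn_fwdK ?dyn_bwdK //=;
  case: eqP => [->//|_]; case: eqP => [->|].
Qed.

Lemma dyn_letter_comm i j b c st : i.+2 <= j ->
  dyn_letter i b (dyn_letter j c st) = dyn_letter j c (dyn_letter i b st).
Proof.
move=> ij; apply: funext => k; rewrite /dyn_letter.
have e1 : (i.+1 == j.+1) = false by lia.
have e2 : (i.+1 == j) = false by lia.
have e3 : (i == j.+1) = false by lia.
have e4 : (i == j) = false by lia.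
have e5 : (j.+1 == i.+1) = false by lia.
have e6 : (j.+1 == i) = false by lia.
have e7 : (j == i.+1) = false by lia.
have e8 : (j == i) = false by lia.
rewrite ?(e1, e2, e3, e4, e5, e6, e7, e8).
case: (k =P i.+1) => [->|_]; first by rewrite e1 e2.
by case: (k =P i) => [->|_ //]; rewrite e3 e4.
Qed.

Lemma dyn_letter_braid j st : pos_state st ->
  dyn_letter j.+1 true (dyn_letter j true (dyn_letter j.+1 true st)) =
  dyn_letter j true (dyn_letter j.+1 true (dyn_letter j true st)).
Proof.
move=> st0; apply: funext => k.
have := dyn_fwd_braid (st0 j.+2) (st0 j.+1) (st0 j); rewrite /= /dyn_letter.
have e1 : (j.+1 == j.+2) = false by lia.
have e2 : (j == j.+2) = false by lia.
have e3 : (j == j.+1) = false by lia.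
have e4 : (j.+2 == j.+1) = false by lia.
have e5 : (j.+2 == j) = false by lia.
rewrite ?(eqxx, e1, e2, e3, e4, e5) => -[E1 E2 E3].
have [->|k2] : k = j.+2 \/ (k == j.+2) = false by lia.
  by rewrite ?(eqxx, e1, e2, e3, e4, e5).
have [->|k1] : k = j.+1 \/ (k == j.+1) = false by lia.
  by rewrite ?(eqxx, e1, e2, e3, e4, e5).
have [->|k0] : k = j \/ (k == j) = false by lia.
  by rewrite ?(eqxx, e1, e2, e3, e4, e5).
by rewrite k2 k1 k0.
Qed.

Lemma dyn_word_cat n (u v : word n) st :
  dyn_word (u ++ v) st = dyn_word u (dyn_word v st).
Proof. by rewrite /dyn_word foldr_cat. Qed.

Lemma dyn_word_equiv n (u v : word n) st :
  word_equiv u v -> pos_state st -> dyn_word u st = dyn_word v st.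
Proof.
move=> uv; elim: uv st => {u v} [u|u v _ IH|u v w _ IH1 _ IH2|u v w w' _ IH|i s|i j ij|i j ij] st st0.
- by [].
- by rewrite IH.
- by rewrite IH1 ?IH2.
- by rewrite !dyn_word_cat IH //; apply: pos_dyn_word.
- by rewrite /= dyn_letterK.
- by case/orP: ij => ij; rewrite /= ?(dyn_letter_comm _ _ _ ij).
- by case/orP: ij => /eqP ij; rewrite /= ij dyn_letter_braid.
Qed.

(** A letter of index j acts on the coordinates j and j + 1 only, so the coordinate [(val i).+1] is
    touched by the letters of index [val i] alone. A positive one adds y1 * (x1 + x2) > 0 to its
    first component. *)
Lemma dyn_word_incr n (i : {i : nat | 0 < i < n}) (w : word n) st :
  pos_state st -> (i, false) \notin w -> all (fun l => val l.1 <= val i) w ->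
  ((st (val i).+1).1 <= (dyn_word w st (val i).+1).1)%R
  /\ ((i, true) \in w -> (st (val i).+1).1 < (dyn_word w st (val i).+1).1)%R.
Proof.
move=> st0; elim: w => [|[j b] w IH] /=; first by rewrite lexx.
rewrite inE negb_or => /andP [ib iw] /andP [ji wi].
have {IH} [IH1 IH2] := IH iw wi.
have W0 := pos_dyn_word w st0.
case: (altP (j =P i)) => [eji|ji'].
  have -> : b = true by case: b ib => //; rewrite eji eqxx.
  have lt : ((dyn_word w st (val i).+1).1 <
     (dyn_letter (val j) true (dyn_word w st) (val i).+1).1)%R.
    rewrite eji /dyn_letter /= eqxx /dyn_fwd /=.
    move: (W0 (val i).+1) (W0 (val i)); case: (dyn_word _ _ _) => x1 y1.
    case: (dyn_word _ _ _) => x2 y2 /andP [/= ? ?] /andP [/= ? ?].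
    by rewrite ltrDl; pos_tac.
  by split=> [|_]; [apply: ltW|]; apply: le_lt_trans lt.
have jlt : val j < val i by rewrite ltn_neqAle ji andbT.
have -> : dyn_letter (val j) b (dyn_word w st) (val i).+1 = dyn_word w st (val i).+1.
  rewrite /dyn_letter.
  have -> : ((val i).+1 == (val j).+1) = false by lia.
  by have -> : ((val i).+1 == val j) = false by lia.
split=> //; rewrite inE => /orP [/eqP [e _]|//].
by rewrite e eqxx in ji'.
Qed.

Lemma sigma_positive_neq1 n : ~ sigma_positive (1 : braid n).
Proof.
case=> i [w [/and3P [iw niw wi] w1]].
have e : word_equiv w [::] by apply/braid_of_wordP.
have st0 : pos_state (fun _ => (1%R, 1%R)) by [].
have [_ /(_ iw)] := dyn_word_incr st0 niw wi.
by rewrite (dyn_word_equiv e st0) /= ltxx.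
Qed.

(** * Generators, exponent sum and parabolic subgroups *)

Lemma braid_of_wordM n (u v : word n) :
  braid_of_word (u ++ v) = braid_of_word u * braid_of_word v.
Proof. exact: braid_of_word_cat. Qed.

Lemma braid_of_word1 n : braid_of_word [::] = 1 :> braid n.
Proof. by []. Qed.

Lemma sigmaE n (i : {i : nat | 0 < i < n}) :
  sigma n (val i) = braid_of_word [:: (i, true)].
Proof. by rewrite /sigma valK. Qed.

Lemma sigmaVE n (i : {i : nat | 0 < i < n}) :
  (sigma n (val i))^-1 = braid_of_word [:: (i, false)].
Proof.
apply: mulg1_eq; rewrite sigmaE -braid_of_wordM.
exact/braid_of_wordP/word_equiv_cancel.
Qed.

Lemma sigma_out n i : ~~ (0 < i < n) -> sigma n i = 1.
Proof. by move=> h; rewrite /sigma insubN. Qed.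

Lemma sigma_comm n i j : i.+2 <= j -> commute (sigma n i) (sigma n j).
Proof.
move=> ij; have [hi|/sigma_out ->] := boolP (0 < i < n); last first.
  exact/commute_sym/commute1.
have [hj|/sigma_out ->] := boolP (0 < j < n); last exact: commute1.
rewrite /commute -[i]/(val (exist (fun i => 0 < i < n) i hi)).
rewrite -[j in LHS]/(val (exist (fun i => 0 < i < n) j hj)).
rewrite -[j in RHS]/(val (exist (fun i => 0 < i < n) j hj)).
rewrite !sigmaE -!braid_of_wordM; apply/braid_of_wordP/word_equiv_comm.
by rewrite /= ij.
Qed.

Lemma sigma_braid n i : 0 < i -> i.+1 < n ->
  sigma n i * sigma n i.+1 * sigma n i = sigma n i.+1 * sigma n i * sigma n i.+1.
Proof.
move=> i0 iN; have hi : 0 < i < n by lia.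
have hj : 0 < i.+1 < n by lia.
have -> : sigma n i = braid_of_word [:: (exist (fun i => 0 < i < n) i hi, true)].
  by rewrite -sigmaE.
have -> : sigma n i.+1 = braid_of_word [:: (exist (fun i => 0 < i < n) i.+1 hj, true)].
  by rewrite -sigmaE.
rewrite -!braid_of_wordM; apply/braid_of_wordP/word_equiv_braid.
by rewrite /= eqxx.
Qed.

(** The exponent sum. It is 1 on every band generator, so on the dual monoids it is a word length
    and serves as induction measure. *)
Definition word_len n (w : word n) : int := (\sum_(l <- w) (if l.2 then 1 else -1))%R.
Definition braid_len n (x : braid n) : int := word_len (repr x).

Lemma word_len_cat n (u v : word n) : (word_len (u ++ v) = word_len u + word_len v)%R.
Proof. by rewrite /word_len big_cat. Qed.

Lemma word_len_equiv n (u v : word n) : word_equiv u v -> word_len u = word_len v.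
Proof.
elim=> // {u v} [u v w _ -> _ -> //|u v w w' _ IH|i s|i j _|i j _].
- by rewrite !word_len_cat IH.
- by rewrite /word_len !big_cons big_nil /=; case: s.
- by rewrite /word_len !big_cons big_nil.
- by rewrite /word_len !big_cons big_nil.
Qed.

Lemma braid_len_word n (w : word n) : braid_len (braid_of_word w) = word_len w.
Proof. exact/word_len_equiv/word_equiv_repr. Qed.

Lemma braid_len1 n : braid_len (1 : braid n) = 0%R.
Proof. by rewrite -braid_of_word1 braid_len_word /word_len big_nil. Qed.

Lemma braid_lenM n (x y : braid n) : braid_len (x * y) = (braid_len x + braid_len y)%R.
Proof.
by rewrite -(braid_of_wordK x) -(braid_of_wordK y) -braid_of_wordM !braid_len_word
  word_len_cat.
Qed.

Lemma braid_lenV n (x : braid n) : braid_len x^-1 = (- braid_len x)%R.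
Proof. by apply/eqP; rewrite -addr_eq0 -braid_lenM mulVg braid_len1. Qed.

Lemma braid_lenJ n (x y : braid n) : braid_len (x * y * x^-1) = braid_len y.
Proof. by rewrite !braid_lenM braid_lenV addrAC addrN add0r. Qed.

Lemma braid_len_sigma n i : 0 < i < n -> braid_len (sigma n i) = 1%R.
Proof.
move=> hi; rewrite -[i]/(val (exist (fun i => 0 < i < n) i hi)) sigmaE.
by rewrite braid_len_word /word_len big_cons big_nil.
Qed.

(** The subgroup of braids on the strands l, ..., h. No bound by N is imposed, because [sigma] is 1
    outside its range. *)
Inductive parabolic N l h : braid N -> Prop :=
| parabolic_one : parabolic l h 1
| parabolic_cons i x : l <= i < h -> parabolic l h x -> parabolic l h (sigma N i * x)
| parabolic_consV i x : l <= i < h -> parabolic l h x -> parabolic l h ((sigma N i)^-1 * x).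
Arguments parabolic N l h x : clear implicits.

Lemma parabolicM N l h x y : parabolic N l h x -> parabolic N l h y -> parabolic N l h (x * y).
Proof.
by elim=> [|i z hi _ IH|i z hi _ IH] hy; rewrite ?mul1g -?mulgA //;
  [apply: parabolic_cons|apply: parabolic_consV]; auto.
Qed.

Lemma parabolic_sigma N l h i : l <= i < h -> parabolic N l h (sigma N i).
Proof. by move=> hi; rewrite -[sigma N i]mulg1; apply: parabolic_cons => //; apply: parabolic_one. Qed.

Lemma parabolic_sigmaV N l h i : l <= i < h -> parabolic N l h (sigma N i)^-1.
Proof. by move=> hi; rewrite -[_^-1]mulg1; apply: parabolic_consV => //; apply: parabolic_one. Qed.

Lemma parabolicV N l h x : parabolic N l h x -> parabolic N l h x^-1.
Proof.
elim=> [|i z hi _ IH|i z hi _ IH]; first by rewrite invg1; apply: parabolic_one.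
  by rewrite invgM; apply: parabolicM => //; apply: parabolic_sigmaV.
by rewrite invgM invgK; apply: parabolicM => //; apply: parabolic_sigma.
Qed.

Lemma parabolicS N l h l' h' x : l' <= l -> h <= h' -> parabolic N l h x -> parabolic N l' h' x.
Proof.
move=> hl hh; elim=> [|i z hi _ IH|i z hi _ IH]; first exact: parabolic_one.
  by apply: parabolic_cons => //; lia.
by apply: parabolic_consV => //; lia.
Qed.

Lemma commuteVl (G : groupType) (x y : G) : commute x y -> commute x^-1 y.
Proof. by move=> h; apply/commute_sym/commuteV/commute_sym. Qed.

Lemma commuteMl (G : groupType) (x y z : G) :
  commute x z -> commute y z -> commute (x * y) z.
Proof. by move=> h1 h2; apply/commute_sym/commuteM; apply: commute_sym. Qed.

Lemma parabolic_comm N l h l' h' x y : h < l' ->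
  parabolic N l h x -> parabolic N l' h' y -> commute x y.
Proof.
move=> hl; elim=> [|i z hi _ IH|i z hi _ IH] hy; first exact/commute_sym/commute1.
  apply: commuteMl; last exact: IH.
  elim: hy => [|j t hj _ IHt|j t hj _ IHt]; first exact: commute1.
    by apply: commuteM => //; apply: sigma_comm; lia.
  by apply: commuteM => //; apply: commuteV; apply: sigma_comm; lia.
apply: commuteMl; last exact: IH.
apply: commuteVl.
elim: hy => [|j t hj _ IHt|j t hj _ IHt]; first exact: commute1.
  by apply: commuteM => //; apply: sigma_comm; lia.
by apply: commuteM => //; apply: commuteV; apply: sigma_comm; lia.
Qed.

(** * Sigma-nonnegative braids and the orders on cosets *)

Inductive sigma_nonneg N k : braid N -> Prop :=
| nonneg_parabolic x : parabolic N 1 k x -> sigma_nonneg k x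
| nonneg_cons x y : parabolic N 1 k x -> sigma_nonneg k y -> sigma_nonneg k (x * sigma N k * y).
Arguments sigma_nonneg N k x : clear implicits.

Definition sigma_pos N k (x : braid N) : Prop :=
  exists a b, [/\ sigma_nonneg N k a, sigma_nonneg N k b & x = a * sigma N k * b].
Arguments sigma_pos N k x : clear implicits.

Lemma nonneg1 N k : sigma_nonneg N k 1.
Proof. exact/nonneg_parabolic/parabolic_one. Qed.

Lemma nonneg_sigma N k : sigma_nonneg N k (sigma N k).
Proof.
rewrite -[sigma N k]mul1g -[_ * _]mulg1.
by apply: nonneg_cons; [apply: parabolic_one|apply: nonneg1].
Qed.

Lemma nonnegM N k x y : sigma_nonneg N k x -> sigma_nonneg N k y -> sigma_nonneg N k (x * y).
Proof.
elim=> [a ha|a b ha _ IH] hy; last by rewrite -mulgA; apply: nonneg_cons; auto.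
case: hy => [b hb|b c hb hc]; first exact/nonneg_parabolic/parabolicM.
by rewrite !mulgA; apply: nonneg_cons => //; apply: parabolicM.
Qed.

Lemma pos_sigma N k : sigma_pos N k (sigma N k).
Proof. by exists 1, 1; split; rewrite ?mul1g ?mulg1 //; apply: nonneg1. Qed.

Lemma posMl N k x y : sigma_nonneg N k x -> sigma_pos N k y -> sigma_pos N k (x * y).
Proof.
move=> hx [a [b [ha hb ->]]]; exists (x * a), b.
by split; rewrite ?mulgA //; apply: nonnegM.
Qed.

Lemma posMr N k x y : sigma_pos N k x -> sigma_nonneg N k y -> sigma_pos N k (x * y).
Proof.
move=> [a [b [ha hb ->]]] hy; exists a, (b * y).
by split; rewrite ?mulgA //; apply: nonnegM.
Qed.

Lemma pos_nonneg N k x : sigma_pos N k x -> sigma_nonneg N k x.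
Proof.
move=> [a [b [ha hb ->]]]; apply: nonnegM => //; apply: nonnegM => //.
exact: nonneg_sigma.
Qed.

Lemma nonneg_parabolic_or_pos N k x : sigma_nonneg N k x ->
  parabolic N 1 k x \/ exists a b, [/\ sigma_nonneg N k a, parabolic N 1 k b & x = a * sigma N k * b].
Proof.
elim=> [a|a b ha hb [h|[c [d [hc hd ->]]]]]; [by left| |]; right.
  by exists a, b; split=> //; apply: nonneg_parabolic.
exists (a * sigma N k * c), d; split; rewrite ?mulgA //.
exact: nonneg_cons.
Qed.

Lemma pos_last N k x : sigma_pos N k x ->
  exists a b, [/\ sigma_nonneg N k a, parabolic N 1 k b & x = a * sigma N k * b].
Proof.
move=> [a [b [ha hb ->]]]; case: (nonneg_parabolic_or_pos hb) => [h|].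
  by exists a, b.
move=> [c [d [hc hd ->]]]; exists (a * sigma N k * c), d; split; rewrite ?mulgA //.
by apply: nonnegM => //; apply: nonnegM => //; apply: nonneg_sigma.
Qed.

Lemma parabolic_word N k (x : braid N) : parabolic N 1 k x ->
  exists2 w, x = braid_of_word w & all (fun l => val l.1 < k) w.
Proof.
elim=> [|i z hi _ [w -> wk]|i z hi _ [w -> wk]]; first by exists [::].
  have [hN|/sigma_out ->] := boolP (0 < i < N); last by exists w; rewrite ?mul1g.
  exists ((exist (fun i => 0 < i < N) i hN, true) :: w).
    by rewrite -cat1s braid_of_wordM -sigmaE.
  by rewrite /= wk andbT; case/andP: hi.
have [hN|/sigma_out ->] := boolP (0 < i < N); last by exists w; rewrite ?invg1 ?mul1g.
exists ((exist (fun i => 0 < i < N) i hN, false) :: w).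
  by rewrite -cat1s braid_of_wordM -sigmaVE.
by rewrite /= wk andbT; case/andP: hi.
Qed.

Lemma nonneg_word N (k : {i : nat | 0 < i < N}) (x : braid N) : sigma_nonneg N (val k) x ->
  exists2 w, x = braid_of_word w &
    ((k, false) \notin w) && all (fun l => val l.1 <= val k) w.
Proof.
have aux (w : word N) : all (fun l => val l.1 < val k) w ->
    ((k, false) \notin w) && all (fun l => val l.1 <= val k) w.
  move=> wk; apply/andP; split; last by apply: sub_all wk => l /ltnW.
  by apply/negP => /(allP wk) /=; rewrite ltnn.
elim=> [a /parabolic_word [w -> wk]|a b /parabolic_word [u -> uk] _ [w -> /andP[wk1 wk2]]].
  by exists w; rewrite ?aux.
have /andP[uk1 uk2] := aux _ uk.
exists (u ++ (k, true) :: w); first by rewrite -cat1s !braid_of_wordM -sigmaE mulgA.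
rewrite mem_cat inE xpair_eqE andbF orFb negb_or uk1 wk1 /=.
by rewrite all_cat uk2 /= leqnn.
Qed.

Lemma word_nonneg N (k : {i : nat | 0 < i < N}) (w : word N) :
  (k, false) \notin w -> all (fun l => val l.1 <= val k) w ->
  sigma_nonneg N (val k) (braid_of_word w) /\
  ((k, true) \in w -> sigma_pos N (val k) (braid_of_word w)).
Proof.
elim: w => [|[i b] w IH]; first by move=> _ _; split => //; apply: nonneg1.
rewrite inE negb_or => /andP[ib kw] /= /andP[ik wk].
have {IH} [IH1 IH2] := IH kw wk; rewrite -cat1s braid_of_wordM.
case: (altP (i =P k)) => [eik|ik'].
  have -> : b = true by case: b ib => //; rewrite eik eqxx.
  rewrite eik -sigmaE; split=> [|_]; last exact: posMr (pos_sigma _ _) IH1.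
  by apply: nonnegM IH1; apply: nonneg_sigma.
have hi : 1 <= val i < val k.
  by case/andP: (valP i) => -> _ /=; rewrite ltn_neqAle ik andbT.
have h : sigma_nonneg N (val k) (braid_of_word [:: (i, b)]).
  apply: nonneg_parabolic; case: b {ib}; first by rewrite -sigmaE; apply: parabolic_sigma.
  by rewrite -sigmaVE; apply: parabolic_sigmaV.
split; first exact: nonnegM.
rewrite inE => /orP[/eqP[e _]|/IH2]; last exact: posMl.
by rewrite e eqxx in ik'.
Qed.

Lemma sigma_positiveP N (x : braid N) :
  sigma_positive x <-> exists2 k, 0 < k < N & sigma_pos N k x.
Proof.
split=> [[i [w [/and3P[iw niw wi] <-]]]|[k hk [a [b [ha hb ->]]]]].
  by exists (val i); [exact: (valP i)|have [_] := word_nonneg niw wi; apply].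
pose i : {i : nat | 0 < i < N} := exist _ k hk; exists i.
have [u -> /andP[u1 u2]] := @nonneg_word _ i _ ha.
have [v -> /andP[v1 v2]] := @nonneg_word _ i _ hb.
exists (u ++ (i, true) :: v); split; last by rewrite -cat1s !braid_of_wordM -sigmaE mulgA.
rewrite /word_sigma_positive !mem_cat !inE eqxx orbT xpair_eqE andbF orFb negb_or u1 v1.
by rewrite all_cat /= leqnn; apply/andP; split.
Qed.

Lemma nonneg_parabolicS N k k' x : 0 < k < k' -> sigma_nonneg N k x -> parabolic N 1 k' x.
Proof.
move=> hk; elim=> [a|a b ha _ hb]; first by apply: parabolicS => //; lia.
apply: parabolicM => //; apply: parabolicM; last by apply: parabolic_sigma.
by apply: parabolicS ha => //; lia.
Qed.

(** The factor with the smaller top index lies in the parabolic subgroup of the larger one and is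
    absorbed there. *)
Lemma sigma_positiveM N (x y : braid N) :
  sigma_positive x -> sigma_positive y -> sigma_positive (x * y).
Proof.
move=> /sigma_positiveP [k hk hx] /sigma_positiveP [l hl hy]; apply/sigma_positiveP.
have [kl|lk|ekl] := ltngtP k l.
- exists l => //; apply: posMl hy; apply/nonneg_parabolic/(nonneg_parabolicS (k := k)); first by lia.
  exact: pos_nonneg.
- exists k => //; apply: posMr hx _; apply/nonneg_parabolic/(nonneg_parabolicS (k := l)); first by lia.
  exact: pos_nonneg.
- by subst l; exists k => //; apply: posMr hx (pos_nonneg hy).
Qed.

Lemma braid_lt_irr N (x : braid N) : ~ braid_lt x x.
Proof. by rewrite /braid_lt mulVg; apply: sigma_positive_neq1. Qed.

Lemma braid_lt_trans N (x y z : braid N) : braid_lt x y -> braid_lt y z -> braid_lt x z.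
Proof.
by move=> hxy hyz; have := sigma_positiveM hxy hyz; rewrite !mulgA mulgK.
Qed.

(* [cle k x y] and [clt k x y] compare the cosets of [x] and [y] modulo the
   subgroup generated by sigma_1, ..., sigma_(k-1). *)
Definition cle N k (x y : braid N) : Prop := sigma_nonneg N k (x^-1 * y).
Definition clt N k (x y : braid N) : Prop := sigma_pos N k (x^-1 * y).
Arguments cle N k x y : clear implicits.
Arguments clt N k x y : clear implicits.

Lemma cle_trans N k y x z : cle N k x y -> cle N k y z -> cle N k x z.
Proof. by move=> h1 h2; have := nonnegM h1 h2; rewrite /cle !mulgA mulgK. Qed.

Lemma clt_cle_trans N k y x z : clt N k x y -> cle N k y z -> clt N k x z.
Proof. by move=> h1 h2; have := posMr h1 h2; rewrite /clt !mulgA mulgK. Qed.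

Lemma cle_clt_trans N k y x z : cle N k x y -> clt N k y z -> clt N k x z.
Proof. by move=> h1 h2; have := posMl h1 h2; rewrite /clt !mulgA mulgK. Qed.

Lemma cltW N k x y : clt N k x y -> cle N k x y.
Proof. exact: pos_nonneg. Qed.

Lemma cle_mul2l N k z x y : cle N k x y -> cle N k (z * x) (z * y).
Proof. by rewrite /cle invgM !mulgA mulgVK. Qed.

Lemma clt_mul2l N k z x y : clt N k x y -> clt N k (z * x) (z * y).
Proof. by rewrite /clt invgM !mulgA mulgVK. Qed.

Lemma cle_mulr N k x y : sigma_nonneg N k y -> cle N k x (x * y).
Proof. by rewrite /cle mulKg. Qed.

Lemma clt_mulr N k x y : sigma_pos N k y -> clt N k x (x * y).
Proof. by rewrite /clt mulKg. Qed.

Lemma cle_parabolicr N k x u : parabolic N 1 k u -> cle N k (x * u) x.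
Proof. by move=> hu; rewrite /cle invgM -mulgA mulVg mulg1; apply/nonneg_parabolic/parabolicV. Qed.

Lemma cle_refl N k x : cle N k x x.
Proof. by rewrite /cle mulVg; apply: nonneg1. Qed.

(** * Products of consecutive generators, and the relations between band generators *)

Definition delta_seg N l h : braid N := \prod_(l <= i < h) sigma N i.
Local Notation D := delta_seg.

Lemma delta_seg_nil N l h : h <= l -> D N l h = 1.
Proof. exact: big_geq. Qed.

Lemma delta_seg_recr N l h : l <= h -> D N l h.+1 = D N l h * sigma N h.
Proof. exact: big_nat_recr. Qed.

Lemma delta_seg_recl N l h : l < h -> D N l h = sigma N l * D N l.+1 h.
Proof. exact: big_ltn. Qed.

Lemma delta_seg_cat N k l h : l <= k -> k <= h -> D N l h = D N l k * D N k h.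
Proof. exact: big_cat_nat. Qed.

Lemma bandE N p q : p < q -> band N p q = D N p q * (D N p q.-1)^-1.
Proof.
by case: q => // q pq; rewrite delta_seg_recr.
Qed.

Lemma parabolic_delta_seg N l h l' h' : l' <= l -> h <= h' -> parabolic N l' h' (D N l h).
Proof.
move=> hl hh; have [lh|/delta_seg_nil ->] := ltnP l h; last exact: parabolic_one.
elim: h lh hh => // h IH; rewrite ltnS => lh hh; rewrite delta_seg_recr //.
apply: parabolicM; last by apply: parabolic_sigma; lia.
have [lh'|/delta_seg_nil ->] := ltnP l h; last exact: parabolic_one.
by apply: IH; lia.
Qed.

Lemma parabolic_band N p q l h : p < q -> l <= p -> q <= h -> parabolic N l h (band N p q).
Proof.
by move=> pq lp qh; rewrite bandE //; apply: parabolicM; [|apply: parabolicV];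
  apply: parabolic_delta_seg; lia.
Qed.

(** Cut the product around sigma_i sigma_(i+1): the outer pieces commute with the generator that has
    to cross them, and the braid relation settles the middle. *)
Lemma delta_seg_sigma N l h i : 0 < l -> l <= i -> i.+1 < h -> h <= N ->
  sigma N i.+1 * D N l h = D N l h * sigma N i.
Proof.
move=> l0 li ih hN.
rewrite (@delta_seg_cat _ i) 1?(@delta_seg_recl _ i) 1?(@delta_seg_recl _ i.+1); [|lia..].
have c1 : sigma N i.+1 * D N l i = D N l i * sigma N i.+1.
  apply/commute_sym; apply: (@parabolic_comm _ l i i.+1 i.+2) => //.
    exact: parabolic_delta_seg.
  by apply: parabolic_sigma; lia.
have c2 : D N i.+2 h * sigma N i = sigma N i * D N i.+2 h.
  apply/commute_sym; apply: (@parabolic_comm _ i i.+1 i.+2 h) => //.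
    by apply: parabolic_sigma; lia.
  exact: parabolic_delta_seg.
transitivity (D N l i * (sigma N i.+1 * sigma N i * sigma N i.+1) * D N i.+2 h).
  by rewrite !mulgA c1.
by rewrite -sigma_braid; [rewrite -!mulgA c2|lia..].
Qed.

(** Conjugation y = d^-1 x d written without inverses, so that it composes by plain rewriting. *)
Definition intertwines N (d x y : braid N) : Prop := x * d = d * y.

Lemma intertwinesM N (d x y x' y' : braid N) :
  intertwines d x y -> intertwines d x' y' -> intertwines d (x * x') (y * y').
Proof. by rewrite /intertwines => h h'; rewrite -mulgA h' !mulgA h. Qed.

Lemma intertwinesV N (d x y : braid N) :
  intertwines d x y -> intertwines d x^-1 y^-1.
Proof.
rewrite /intertwines => h; apply: (mulgI x); rewrite mulVKg mulgA h.
by rewrite -mulgA mulgV mulg1.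
Qed.

Lemma parabolic_shift N l h x : 0 < l -> h <= N -> parabolic N l.+1 h x ->
  exists2 y, parabolic N l h.-1 y & intertwines (D N l h) x y.
Proof.
move=> l0 hN; elim=> [|[//|i] z hi _ [y hy e]|[//|i] z hi _ [y hy e]].
- by exists 1; [apply: parabolic_one|rewrite /intertwines mul1g mulg1].
- exists (sigma N i * y); first by apply: parabolic_cons => //; lia.
  by apply: intertwinesM => //; apply: delta_seg_sigma; lia.
- exists ((sigma N i)^-1 * y); first by apply: parabolic_consV => //; lia.
  by apply: intertwinesM => //; apply: intertwinesV; apply: delta_seg_sigma; lia.
Qed.

Lemma parabolic_unshift N l h y : 0 < l -> h <= N -> parabolic N l h.-1 y ->
  exists2 x, parabolic N l.+1 h x & intertwines (D N l h) x y.
Proof.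
move=> l0 hN; elim=> [|i z hi _ [x hx e]|i z hi _ [x hx e]].
- by exists 1; [apply: parabolic_one|rewrite /intertwines mul1g mulg1].
- exists (sigma N i.+1 * x); first by apply: parabolic_cons => //; lia.
  by apply: intertwinesM => //; apply: delta_seg_sigma; lia.
- exists ((sigma N i.+1)^-1 * x); first by apply: parabolic_consV => //; lia.
  by apply: intertwinesM => //; apply: intertwinesV; apply: delta_seg_sigma; lia.
Qed.

Lemma delta_seg_shift N l h p q : 0 < l -> l <= p -> q < h -> h <= N ->
  intertwines (D N l h) (D N p.+1 q.+1) (D N p q).
Proof.
move=> l0 lp qh hN; elim: q qh => [|q IH] qh.
  by rewrite (@delta_seg_nil _ p.+1) // (@delta_seg_nil _ p) // /intertwines mul1g mulg1.
have [pq|qp] := leqP p q; last first.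
  by rewrite (@delta_seg_nil _ p.+1) // (@delta_seg_nil _ p) // /intertwines mul1g mulg1.
rewrite (@delta_seg_recr _ p.+1 q.+1) // (@delta_seg_recr _ p q) //.
by apply: intertwinesM; [apply: IH; lia|apply: delta_seg_sigma; lia].
Qed.

Lemma band_shift N l h p q : 0 < l -> l <= p -> p < q -> q < h -> h <= N ->
  intertwines (D N l h) (band N p.+1 q.+1) (band N p q).
Proof.
move=> l0 lp pq qh hN; rewrite !bandE //; apply: intertwinesM.
  exact: delta_seg_shift.
apply: intertwinesV; case: q pq qh => // q pq qh; apply: delta_seg_shift => //.
exact: ltnW.
Qed.

(** Conjugation by the segment rotates the strands l, ..., h: here p goes to p + 1 and h wraps
    around to l. *)
Lemma band_wrap N l h p : 0 < l -> l <= p -> p < h -> h <= N ->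
  D N l h * band N p h = band N l p.+1 * D N l h.
Proof.
move=> l0 lp ph hN; rewrite !bandE //=.
have e : D N p.+1 h * D N p h = D N p h * D N p h.-1.
  by case: h ph hN => // h ph hN; apply: delta_seg_shift => //; lia.
rewrite [in LHS](@delta_seg_cat _ p.+1 l h) // 1?ltnW // -!mulgA [D N p.+1 h * _]mulgA e.
by rewrite mulgK (@delta_seg_cat _ p l h) ?mulKg // ltnW.
Qed.

(** The Birman-Ko-Lee relation of the triangle r < s < t. With [band_triple'] it identifies the
    three products of two sides taken in cyclic order. *)
Lemma band_triple N r s t : 0 < r -> r < s -> s < t -> t <= N ->
  band N r s * band N s t = band N r t * band N r s.
Proof.
move=> r0 rs st tN; rewrite (@bandE _ r s) // (@bandE _ r t); last by lia.
have c : commute (D N r s.-1)^-1 (band N s t).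
  apply: (@parabolic_comm _ r s.-1 s t); [lia| |by apply: parabolic_band].
  by apply/parabolicV/parabolic_delta_seg.
rewrite -mulgA c bandE // !mulgA.
rewrite (@delta_seg_cat _ s r t) 1?(@delta_seg_cat _ s r t.-1); [|lia..].
by rewrite invgM !mulgA mulgVK.
Qed.

Lemma band_triple' N r s t : 0 < r -> r < s -> s < t -> t <= N ->
  band N s t * band N r t = band N r t * band N r s.
Proof.
move=> r0 rs st tN; rewrite (@bandE _ r t); last by lia.
case: s rs st => // s rs st; case: t st tN => // t st tN.
have e1 : band N s.+1 t.+1 * D N r t.+1 = D N r t.+1 * band N s t by apply: band_shift.
have e2 : D N r t * band N s t = band N r s.+1 * D N r t.
  by apply: band_wrap => //; apply: ltnW.
have e3 : band N s t * (D N r t)^-1 = (D N r t)^-1 * band N r s.+1.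
  by apply: (mulgI (D N r t)); rewrite mulVKg mulgA e2 mulgK.
by rewrite mulgA e1 /= -[LHS]mulgA e3 mulgA.
Qed.

Lemma band_comm_far N p q r s : p < q -> q < r -> r < s ->
  commute (band N p q) (band N r s).
Proof.
by move=> pq qr rs; apply: (@parabolic_comm _ p q r s) => //; apply: parabolic_band.
Qed.

(** Moved from left to right through the outer chord, the inner chord has its indices lowered by
    [D N p q] and raised back by the inverse of [D N p q.-1]. *)
Lemma band_comm_nested N p q r s : 0 < p -> p < r -> r < s -> s < q -> q <= N ->
  commute (band N p q) (band N r s).
Proof.
move=> p0 pr rs sq qN; rewrite /commute (@bandE _ p q); last by lia.
case: r s pr rs sq => // r [//|s] pr rs sq.
have e1 : band N r.+1 s.+1 * D N p q = D N p q * band N r s by apply: band_shift => //; lia.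
have e2 : band N r.+1 s.+1 * D N p q.-1 = D N p q.-1 * band N r s.
  by apply: band_shift; lia.
have e3 : band N r s * (D N p q.-1)^-1 = (D N p q.-1)^-1 * band N r.+1 s.+1.
  by apply: (mulgI (D N p q.-1)); rewrite mulVKg mulgA -e2 mulgK.
by rewrite [RHS]mulgA e1 -[RHS]mulgA e3 -mulgA.
Qed.

(** * Conjugation by delta, and the dual monoids *)

(** This is [phi] on n strands inside an ambient group on N strands, so that the induction on the
    number of strands never changes the group. For N = n it is convertible to [phi]. *)
Definition delta_conj N n (x : braid N) : braid N := D N 1 n * x * (D N 1 n)^-1.

Lemma delta_conjM N n (x y : braid N) : delta_conj n (x * y) = delta_conj n x * delta_conj n y.
Proof. by rewrite /delta_conj !mulgA mulgVK. Qed.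

Lemma delta_conj1 N n : delta_conj n (1 : braid N) = 1.
Proof. by rewrite /delta_conj mulg1 mulgV. Qed.

Lemma delta_conj_inj N n : injective (@delta_conj N n).
Proof. by move=> x y /mulIg /mulgI. Qed.

Lemma delta_conj_band N n p q : 0 < p -> p < q -> q < n -> n <= N ->
  delta_conj n (band N p q) = band N p.+1 q.+1.
Proof.
move=> p0 pq qn nN; apply: (mulIg (D N 1 n)); rewrite mulgVK; apply/esym.
exact: band_shift.
Qed.

Lemma delta_conj_band_top N n p : 0 < p -> p < n -> n <= N ->
  delta_conj n (band N p n) = band N 1 p.+1.
Proof. by move=> p0 pn nN; apply: (mulIg (D N 1 n)); rewrite mulgVK band_wrap. Qed.

Lemma delta_conj_parabolic N n l h x : 0 < l -> h < n -> n <= N -> parabolic N l h x ->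
  parabolic N l.+1 h.+1 (delta_conj n x).
Proof.
move=> l0 hn nN hx; have hx' : parabolic N 1 n.-1 x by apply: parabolicS hx; lia.
have e i : 0 < i -> i.+1 < n -> delta_conj n (sigma N i) = sigma N i.+1.
  by move=> i0 iN; apply: (mulIg (D N 1 n)); rewrite mulgVK delta_seg_sigma.
have eV i : 0 < i -> i.+1 < n -> delta_conj n (sigma N i)^-1 = (sigma N i.+1)^-1.
  by move=> i0 iN; apply/esym/mulg1_eq; rewrite -e // -delta_conjM mulgV delta_conj1.
elim: hx {hx'} => [|i z hi _ IH|i z hi _ IH]; first by rewrite delta_conj1; apply: parabolic_one.
  by rewrite delta_conjM e; [apply: parabolic_cons|lia..].
by rewrite delta_conjM eV; [apply: parabolic_consV|lia..].
Qed.

Definition valid_band m (a : nat * nat) := [&& 0 < a.1, a.1 < a.2 & a.2 <= m].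
Definition band_word N (w : seq (nat * nat)) : braid N := \prod_(a <- w) band N a.1 a.2.

Lemma band_word_cons N a w : band_word N (a :: w) = band N a.1 a.2 * band_word N w.
Proof. exact: big_cons. Qed.

Lemma band_word_nil N : band_word N [::] = 1.
Proof. exact: big_nil. Qed.

Lemma band_word_rcons N a w : band_word N (rcons w a) = band_word N w * band N a.1 a.2.
Proof. by rewrite /band_word big_rcons. Qed.

Lemma dual_band_word N m w : all (valid_band m) w -> dual N m (band_word N w).
Proof.
elim: w => [_|a w IH /= /andP[/and3P[? ? ?] /IH h]].
  by rewrite band_word_nil; apply: dual_one.
by rewrite band_word_cons; apply: dual_mul => //; apply: dual_band.
Qed.

Lemma dualP N m x : dual N m x -> exists2 w, all (valid_band m) w & x = band_word N w.
Proof.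
elim=> [|p q p0 pq qm|y z _ [u hu ->] _ [v hv ->]].
- by exists [::]; rewrite ?band_word_nil.
- by exists [:: (p, q)]; rewrite ?band_word_cons ?band_word_nil ?mulg1 /valid_band /= ?p0 ?pq ?qm.
- by exists (u ++ v); rewrite ?all_cat ?hu ?hv // /band_word big_cat.
Qed.

Lemma dualS N m m' x : m <= m' -> dual N m x -> dual N m' x.
Proof.
move=> hm; elim=> [|p q p0 pq qm|y z _ hy _ hz]; first exact: dual_one.
  by apply: dual_band => //; apply: leq_trans hm.
exact: dual_mul.
Qed.

Lemma dual_delta_conj N n x : n <= N -> dual N n x -> dual N n (delta_conj n x).
Proof.
move=> nN; elim=> [|p q p0 pq|y z _ hy _ hz]; first by rewrite delta_conj1; apply: dual_one.
  rewrite leq_eqVlt => /orP[/eqP qn|qn].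
    by subst q; rewrite delta_conj_band_top //; apply: dual_band.
  by rewrite delta_conj_band //; apply: dual_band.
by rewrite delta_conjM; apply: dual_mul.
Qed.

Lemma dual_delta_conjP N n x : n <= N -> dual N n x -> exists2 y, dual N n y & delta_conj n y = x.
Proof.
move=> nN; elim=> [|p q p0 pq qn|y z _ [y' hy <-] _ [z' hz <-]].
- by exists 1; [apply: dual_one|rewrite delta_conj1].
- have [p1|p1] := leqP p 1.
    case: q pq qn => // q pq qn; exists (band N q n).
      by apply: dual_band; lia.
    rewrite delta_conj_band_top; [|lia..].
    by have -> : p = 1%N by lia.
  case: p p0 pq p1 => // p p0 pq p1; case: q pq qn => // q pq qn.
  by exists (band N p q); [apply: dual_band; lia|rewrite delta_conj_band //; lia].
- by exists (y' * z'); [apply: dual_mul|rewrite delta_conjM].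
Qed.

Lemma braid_len_delta_conj N n (x : braid N) : braid_len (delta_conj n x) = braid_len x.
Proof. exact: braid_lenJ. Qed.

Lemma braid_len_band N p q : 0 < p -> p < q -> q <= N -> braid_len (band N p q) = 1%R.
Proof.
move=> p0 pq qN; rewrite bandE //; case: q pq qN => // q pq qN.
rewrite delta_seg_recr // braid_lenJ braid_len_sigma //; lia.
Qed.

Lemma braid_len_band_word N w : all (valid_band N) w ->
  braid_len (band_word N w) = (size w)%:R%R.
Proof.
elim: w => [_|a w IH /= /andP[/and3P[? ? ?] /IH h]].
  by rewrite band_word_nil braid_len1.
by rewrite band_word_cons braid_lenM braid_len_band // h -natr1 addrC.
Qed.

Lemma dual_parabolic N m x : dual N m x -> parabolic N 1 m x.
Proof.
elim=> [|p q p0 pq qm|y z _ hy _ hz]; first exact: parabolic_one.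
  exact: parabolic_band.
exact: parabolicM.
Qed.

Lemma band_top_pos N p k : 0 < p -> p <= k -> sigma_pos N k (band N p k.+1).
Proof.
move=> p0 pk; rewrite bandE //= delta_seg_recr //; apply: posMr.
  by apply: posMl (pos_sigma _ _); apply/nonneg_parabolic/parabolic_delta_seg.
by apply/nonneg_parabolic/parabolicV/parabolic_delta_seg.
Qed.

Lemma dual_nonneg N k x : dual N k.+1 x -> sigma_nonneg N k x.
Proof.
elim=> [|p q p0 pq|y z _ hy _ hz]; first exact: nonneg1.
  rewrite leq_eqVlt => /orP[/eqP e|qk].
    by subst q; apply/pos_nonneg/band_top_pos.
  by apply/nonneg_parabolic/parabolic_band.
exact: nonnegM.
Qed.

(** * Absence of tails, and thresholds along band words *)

(** Triviality of the B_(m-1)^{+*}-tail tested on generators only, so that no maximal divisor has to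
    be constructed. *)
Definition notail N m (x : braid N) : Prop :=
  forall y r s, dual N m y -> 0 < r -> r < s -> s < m -> x <> y * band N r s.
Arguments notail N m x : clear implicits.

(** Moved through [D N q k.+1], the inverse of e drops to the strands q, ..., k, hence into the
    subgroup defining the cosets. What remains contains sigma_k only positively. *)
Lemma parabolic_cle_delta_seg N k q e : 0 < q -> q <= k -> k < N ->
  parabolic N q.+1 k.+1 e -> cle N k e (D N q k.+1).
Proof.
move=> q0 qk kN he; rewrite /cle.
have [y hy /intertwinesV -> //] := parabolic_shift q0 kN he.
apply: nonnegM; last by apply/nonneg_parabolic/parabolicV; apply: parabolicS hy.
rewrite delta_seg_recr //; apply: nonnegM (nonneg_sigma _ _).
exact/nonneg_parabolic/parabolic_delta_seg.
Qed.

Definition band_step (a : nat * nat) (j : nat) : nat := if a.1 < j <= a.2 then a.1 else j.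
(** Cosets are acted on from the left, so the last letter of the word moves the index first. *)
Definition band_state (w : seq (nat * nat)) (j : nat) : nat := foldr band_step j w.

(** If r < j <= s, the chord carries [D N s k.+1] to [D N r k.+1] up to a right factor in the
    subgroup. In the other positions of j it moves past [D N j k.+1] and leaves a nonnegative factor
    on the right. *)
Lemma band_step_cle N k r s j : k < N -> 0 < r -> r < s -> s <= k.+1 ->
  0 < j -> j <= k.+1 ->
  cle N k (D N (band_step (r, s) j) k.+1) (band N r s * D N j k.+1).
Proof.
move=> kN r0 rs sk j0 jk; rewrite /band_step /=; case: ifP => [/andP[rj js]|nbar].
  apply: (@cle_trans _ _ (band N r s * D N s k.+1)).
    rewrite bandE // -mulgA.
    have -> : (D N r s.-1)^-1 * D N s k.+1 = D N s k.+1 * (D N r s.-1)^-1.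
      apply: (@parabolic_comm _ r s.-1 s k.+1); [lia| |exact: parabolic_delta_seg].
      exact/parabolicV/parabolic_delta_seg.
    rewrite mulgA -delta_seg_cat //; last by lia.
    by apply/cle_mulr/nonneg_parabolic/parabolicV/parabolic_delta_seg => //; lia.
  (* A longer segment has a larger coset: for j < s, [D N s k.+1] is a braid on the strands j + 1,
     ..., k + 1. *)
  apply: cle_mul2l; move: js; rewrite leq_eqVlt => /orP[/eqP ->|js]; first exact: cle_refl.
  by apply: parabolic_cle_delta_seg => //; [lia|apply: parabolic_delta_seg; lia].
have [sj|js] := ltnP s j.
  have -> : band N r s * D N j k.+1 = D N j k.+1 * band N r s.
    by apply: (@parabolic_comm _ r s j k.+1) => //; [apply: parabolic_band|apply: parabolic_delta_seg].
  by apply/cle_mulr/nonneg_parabolic/parabolic_band => //; lia.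
have : j <= r by lia.
rewrite leq_eqVlt => /orP[/eqP ejr|jr].
  subst j.
  have -> : band N r s * D N r k.+1 = D N r k.+1 * ((D N s k.+1)^-1 * D N s.-1 k.+1).
    rewrite bandE // [in LHS](@delta_seg_cat _ s.-1 r k.+1) 1?[in RHS](@delta_seg_cat _ s r k.+1); [|lia..].
    by rewrite -mulgA mulKg -mulgA mulVKg.
  apply: cle_mulr; apply: parabolic_cle_delta_seg => //; [lia..|].
  by case: s rs sk nbar js => // s rs sk nbar js; apply: parabolic_delta_seg.
have [y hy ->] : exists2 y, parabolic N j k y & intertwines (D N j k.+1) (band N r s) y.
  by apply: (@parabolic_shift N j k.+1) => //; apply: parabolic_band.
by apply: cle_mulr; apply: nonneg_parabolic; apply: parabolicS hy.
Qed.

Lemma band_state_le w j : band_state w j <= j.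
Proof.
elim: w => //= a w IH; rewrite /band_step; case: ifP => // /andP[h _].
exact: leq_trans (ltnW h) IH.
Qed.

Lemma band_state_gt0 m w j : all (valid_band m) w -> 0 < j -> 0 < band_state w j.
Proof.
elim: w => //= a w IH /andP[/and3P[h _ _] hw] j0; rewrite /band_step.
by case: ifP => // _; apply: IH.
Qed.

Lemma band_state_cle N k w j : k < N -> all (valid_band k.+1) w -> 0 < j -> j <= k.+1 ->
  cle N k (D N (band_state w j) k.+1) (band_word N w * D N j k.+1).
Proof.
move=> kN hw j0 jk; elim: w hw => [_|[r s] w IH /= /andP[/and3P[/= r0 rs sk] hw]].
  by rewrite band_word_nil mul1g; apply: cle_refl.
rewrite band_word_cons -mulgA; apply: cle_trans (cle_mul2l _ (IH hw)).
apply: band_step_cle => //; first exact: band_state_gt0 hw j0.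
exact: leq_trans (band_state_le _ _) jk.
Qed.

(* The letter (r, s) can be pushed to the right end of the word. *)
Lemma low_band_tail N m w r s : m <= N -> all (valid_band m) w ->
  0 < r -> r < s -> s < band_state w m -> ~ notail N m (band N r s * band_word N w).
Proof.
move=> mN; elim: w r s => [|[r' s'] w IH] r s /=.
  move=> _ r0 rs sm nt; apply: (nt 1 r s) => //; first exact: dual_one.
  by rewrite band_word_nil mulg1 mul1g.
move=> /andP[/and3P[/= r'0 rs' sm'] hw] r0 rs; rewrite /band_step /=.
have low a b : 0 < a -> a < b -> b <= m -> forall r1 s1, 0 < r1 -> r1 < s1 ->
    s1 < band_state w m -> ~ notail N m (band N a b * (band N r1 s1 * band_word N w)).
  move=> a0 ab bm r1 s1 r10 rs1 hs1 nt; apply: (IH r1 s1) => // y p q hy p0 pq qm e.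
  apply: (nt (band N a b * y) p q) => //; last by rewrite e mulgA.
  by apply: dual_mul => //; apply: dual_band.
have sm s1 j : s1 < j -> j <= band_state w m -> s1 <= m.
  by move=> h1 h2; have := band_state_le w m; lia.
case: ifP => [/andP[rj js] sr|nbar sj].
  rewrite band_word_cons mulgA band_comm_far // -mulgA.
  by apply: low => //; apply: ltn_trans sr rj.
have [sj'|js'] := ltnP s' (band_state w m).
  (* The head [(r', s')] lies below the index reached by the rest, so it is the letter pushed to the
     right end, while [(r, s)] stays in front. *)
  by rewrite band_word_cons; apply: low => //; apply: sm sj _.
have sr : s < r' by clear -nbar sj js'; lia.
rewrite band_word_cons mulgA band_comm_far //.
by rewrite -mulgA; apply: low.
Qed.

Lemma notail_suffix N m x y : dual N m x -> notail N m (x * y) -> notail N m y.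
Proof.
move=> hx nt z r s hz r0 rs sm e; apply: (nt (x * z) r s) => //; first exact: dual_mul.
by rewrite e mulgA.
Qed.

(** The chords (q, m+1) and (r, s) are disjoint, share the endpoint q = r, or are nested. The
    excluded positions are the crossing ones and s = q, where the triangle relation has the opposite
    order. *)
Lemma band_top_past N m q r s : 0 < q -> 0 < r -> r < s -> s <= m -> m < N ->
  ~~ (r < q <= s) -> q <= m ->
  exists2 y, dual N m.+1 y & band N q m.+1 * band N r s = y * band N q m.+1.
Proof.
move=> q0 r0 rs sm mN nbar qm.
have [sq|qs] := ltnP s q.
  exists (band N r s); first by apply: dual_band; lia.
  by rewrite (band_comm_far N rs sq) // ltnS (leq_trans qm).
have : q <= r by lia.
rewrite leq_eqVlt => /orP[/eqP eqr|qr].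
  subst r; exists (band N s m.+1); first by apply: dual_band; lia.
  by rewrite band_triple'.
exists (band N r s); first by apply: dual_band; lia.
by rewrite band_comm_nested.
Qed.

(* If the state stays at or above q, no letter crosses the chord (q, m+1), so
   this chord can be pushed through the whole word. *)
Lemma band_top_through N m q w : m < N -> 0 < q -> q <= m -> all (valid_band m) w ->
  notail N m (band_word N w) -> q <= band_state w m ->
  exists2 y, dual N m.+1 y & band N q m.+1 * band_word N w = y * band N q m.+1.
Proof.
move=> mN q0 qm; elim: w => [_ _ _|[r s] w IH /= /andP[/and3P[/= r0 rs sm] hw]].
  by exists 1; [apply: dual_one|rewrite band_word_nil mulg1 mul1g].
rewrite band_word_cons => nt hq.
(* Otherwise [low_band_tail] would push the head to the right end. Hence q <= r in both cases below,
   and the chord passes the head. *)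
have hs : band_state w m <= s.
  by rewrite leqNgt; apply/negP => h; apply: (low_band_tail (ltnW mN) hw r0 rs h).
have nt' : notail N m (band_word N w) by apply: notail_suffix nt; apply: dual_band.
move: hq; rewrite /band_step /=; case: ifP => [/andP[h1 h2] hq|nbar hq].
  have [y hy e] : exists2 y, dual N m.+1 y & band N q m.+1 * band N r s = y * band N q m.+1.
    by apply: band_top_past => //; lia.
  have [|z hz ez] := IH hw nt'; first by lia.
  by exists (y * z); [apply: dual_mul|rewrite mulgA e -mulgA ez mulgA].
have [y hy e] : exists2 y, dual N m.+1 y & band N q m.+1 * band N r s = y * band N q m.+1.
  by apply: band_top_past => //; lia.
have [|z hz ez] := IH hw nt'; first by lia.
by exists (y * z); [apply: dual_mul|rewrite mulgA e -mulgA ez mulgA].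
Qed.

Lemma last_band_top N m w r s : m <= N -> all (valid_band m) w -> valid_band m (r, s) ->
  notail N m (band_word N (rcons w (r, s))) -> s = m.
Proof.
move=> mN hw /and3P[/= r0 rs]; rewrite leq_eqVlt => /orP[/eqP //|sm] nt.
by case: (nt (band_word N w) r s) => //; [apply: dual_band_word|rewrite band_word_rcons].
Qed.

(** The passage of a threshold e through one entry v standing to the right of a_(q,k+2). The index
    ends below q along v, since otherwise [band_top_through] would make a_(q,k+2) a right divisor.
    So e lies under the segment where the index ends, and that segment lies under v' e'. *)
Lemma tail_free_lower_bound N k q v e : k.+1 < N -> 0 < q -> q <= k.+1 ->
  dual N k.+1 v -> v <> 1 -> notail N k.+1 v ->
  (forall y r, dual N k.+2 y -> 0 < r <= k -> band N q k.+2 * v <> y * band N r k.+2) ->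
  parabolic N q k.+1 e ->
  exists p v' e', [/\ 0 < p <= k, dual N k.+1 v', v = v' * band N p k.+1,
    parabolic N p.+1 k.+1 e' & cle N k e (v' * e')].
Proof.
move=> kN q0 qk /dualP [w0 hw0 ->] v1 nt nr he.
case/lastP: w0 hw0 v1 nt nr => [|w [p s]]; first by rewrite band_word_nil.
rewrite all_rcons => /andP[ps hw] _ nt nr.
have kN' : k < N by lia.
have es : s = k.+1 by apply: last_band_top nt.
subst s; have /and3P[/= p0 pk _] := ps.
have hst : band_state (rcons w (p, k.+1)) k.+1 = band_state w p.
  by rewrite /band_state foldr_rcons /band_step /= pk leqnn.
have stq : band_state w p < q.
  rewrite ltnNge; apply/negP => hq.
  have qk' : q <= k by have := band_state_le w p; lia.
  have hw' : all (valid_band k.+1) (rcons w (p, k.+1)) by rewrite all_rcons ps.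
  have [//|y hy e1] := band_top_through kN q0 qk hw' nt; first by rewrite hst.
  by apply: (nr y q) => //; rewrite q0.
exists p, (band_word N w).
case/lastP: w hw nt nr hst stq => [|w [r s]].
  (* For a single letter the index ends at p < q, so e already lives on the strands p + 1, ..., k +
     1. *)
  move=> _ nt nr hst /= pq; exists e; split=> //; rewrite ?p0 //.
  - exact: dual_band_word.
  - by rewrite band_word_cons band_word_nil mulg1 mul1g.
  - exact: parabolicS he.
  - by rewrite band_word_nil mul1g; apply: cle_refl.
rewrite all_rcons => /andP[rs hw] nt nr hst stq.
have /and3P[/= r0 rs' sk] := rs.
have tail x y : dual N k.+1 x -> valid_band k.+1 y -> y.2 <= k ->
    band_word N (rcons (rcons w (r, s)) (p, k.+1)) <> x * band N y.1 y.2.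
  by move=> hx /and3P[h1 h2 _] h3; apply: nt.
have dw x : dual N k.+1 x -> dual N k.+1 (band_word N w * x).
  by move=> hx; apply: dual_mul => //; apply: dual_band_word.
(* The last two letters satisfy r <= p < s: in any other position a band relation rewrites the pair
   with a letter below k + 1 at the end, against [tail]. *)
have rp : r <= p.
  rewrite leqNgt; apply/negP => pr.
  have [esk|sk'] := eqVneq s k.+1.
    subst s; apply: (tail (band_word N w * band N p k.+1) (p, r)) => //=.
    - by apply: dw; apply: dual_band.
    - by rewrite /valid_band /= p0 pr ltnW // (leq_trans rs').
    - by rewrite !band_word_rcons /= -(mulgA _ (band N r _)) band_triple' // mulgA.
  apply: (tail (band_word N w * band N p k.+1) (r, s)) => //=.
  - by apply: dw; apply: dual_band.
  - by rewrite -ltnS ltn_neqAle sk' sk.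
  - by rewrite !band_word_rcons /= -(mulgA _ (band N r _)) -band_comm_nested ?mulgA //; lia.
have ps' : p < s.
  rewrite ltnNge; apply/negP; rewrite leq_eqVlt => /orP[/eqP esp|sp].
    subst s; apply: (tail (band_word N w * band N r k.+1) (r, p)) => //=.
    - by apply: dw; apply: dual_band => //; lia.
    - by rewrite !band_word_rcons /= -(mulgA _ (band N r _)) band_triple ?mulgA.
  apply: (tail (band_word N w * band N p k.+1) (r, s)) => //=.
  - by apply: dw; apply: dual_band.
  - by lia.
  - by rewrite !band_word_rcons /= -(mulgA _ (band N r _)) (band_comm_far N rs' sp) ?mulgA.
have stw : band_state (rcons w (r, s)) p = band_state w r.
  rewrite /band_state foldr_rcons /band_step /=; case: ifP => // h.
  by have -> : r = p by lia.
(* This segment avoids the strands up to p because p < s. The letter (r, s) carries it at least to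
   the segment from r, and w carries that one at least to the segment where the index ends. *)
exists (D N s k.+1); split.
- by rewrite p0.
- by apply: dual_band_word; rewrite all_rcons rs.
- by rewrite band_word_rcons.
- exact: parabolic_delta_seg.
- apply: (@cle_trans _ _ (D N (band_state w r) k.+1)).
    apply: parabolic_cle_delta_seg => //; first exact: band_state_gt0 hw r0.
      by have := band_state_le w r; lia.
    by apply: parabolicS he => //; rewrite -stw.
  apply: (@cle_trans _ _ (band_word N w * D N r k.+1)).
    by apply: band_state_cle => //; lia.
  rewrite band_word_rcons -mulgA; apply: cle_mul2l.
  have := @band_step_cle N k r s s kN' r0 rs' sk.
  by rewrite /band_step /= rs' leqnn /=; apply; lia.
Qed.

Lemma band_succ N p : band N p p.+1 = sigma N p.
Proof. by rewrite bandE //= delta_seg_recr // delta_seg_nil // mul1g invg1 mulg1. Qed.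

Lemma parabolic_trivial N l h x : h <= l -> parabolic N l h x -> x = 1.
Proof. by move=> hl; case=> // i y hi; lia. Qed.

Lemma dual_len N m x : m <= N -> dual N m x ->
  exists2 j : nat, braid_len x = j%:Z%R & j = 0 -> x = 1.
Proof.
move=> mN /(dualS mN) /dualP [w hw ->]; exists (size w).
  by rewrite braid_len_band_word // natz.
by move/size0nil => ->; rewrite band_word_nil.
Qed.

(** * Transport of the coset orders under conjugation *)

Lemma sigma_conj_parabolic N k x : parabolic N 1 k x -> sigma N k.+1 * x = x * sigma N k.+1.
Proof.
move=> hx; apply/commute_sym; apply: (@parabolic_comm _ 1 k k.+1 k.+2) => //.
by apply: parabolic_sigma; rewrite !leqnn.
Qed.

Lemma sigma_conj_sigma N k : 0 < k -> k.+1 < N ->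
  sigma N k.+1 * sigma N k * (sigma N k.+1)^-1 =
  (sigma N k)^-1 * sigma N k.+1 * sigma N k.
Proof.
move=> k0 kN; apply: (mulIg (sigma N k.+1)); rewrite mulgVK.
by apply: (mulgI (sigma N k)); rewrite !mulgA mulgV mul1g sigma_braid.
Qed.

(** sigma_(k+1) centralizes the braids on the strands 1, ..., k and conjugates sigma_k to sigma_k^-1
    sigma_(k+1) sigma_k. This turns the order of index k, used for entries, into the order of index
    k + 1, used for merged braids. *)
Lemma nonneg_conj N k x : 0 < k -> k.+1 < N -> sigma_nonneg N k x ->
  sigma_nonneg N k.+1 (sigma N k.+1 * x * (sigma N k.+1)^-1).
Proof.
move=> k0 kN; have low y : parabolic N 1 k y ->
    sigma_nonneg N k.+1 (sigma N k.+1 * y * (sigma N k.+1)^-1).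
  move=> hy; rewrite sigma_conj_parabolic // mulgK; apply: nonneg_parabolic.
  by apply: parabolicS hy.
elim=> [y hy|a b ha _ hb]; first exact: low.
have -> : sigma N k.+1 * (a * sigma N k * b) * (sigma N k.+1)^-1 =
  (sigma N k.+1 * a * (sigma N k.+1)^-1) *
  (sigma N k.+1 * sigma N k * (sigma N k.+1)^-1) *
  (sigma N k.+1 * b * (sigma N k.+1)^-1) by rewrite !mulgA !mulgVK.
apply: nonnegM hb; apply: nonnegM; first exact: low.
rewrite sigma_conj_sigma //; apply: nonnegM; last first.
  by apply/nonneg_parabolic/parabolic_sigma; lia.
apply: nonnegM (nonneg_sigma _ _); apply/nonneg_parabolic/parabolic_sigmaV; lia.
Qed.

Lemma pos_conj N k x : 0 < k -> k.+1 < N -> sigma_pos N k x ->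
  sigma_pos N k.+1 (sigma N k.+1 * x * (sigma N k.+1)^-1).
Proof.
move=> k0 kN [a [b [ha hb ->]]].
have -> : sigma N k.+1 * (a * sigma N k * b) * (sigma N k.+1)^-1 =
  (sigma N k.+1 * a * (sigma N k.+1)^-1) *
  (sigma N k.+1 * sigma N k * (sigma N k.+1)^-1) *
  (sigma N k.+1 * b * (sigma N k.+1)^-1) by rewrite !mulgA !mulgVK.
apply: posMr (nonneg_conj k0 kN hb); apply: posMl; first exact: nonneg_conj.
rewrite sigma_conj_sigma //; apply: posMr; last first.
  by apply/nonneg_parabolic/parabolic_sigma; lia.
apply: posMl (pos_sigma _ _); apply/nonneg_parabolic/parabolic_sigmaV; lia.
Qed.

Lemma cle_conj N k x y : 0 < k -> k.+1 < N -> cle N k x y ->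
  cle N k.+1 (x * (sigma N k.+1)^-1) (y * (sigma N k.+1)^-1).
Proof.
by move=> k0 kN /(nonneg_conj k0 kN); rewrite /cle invgM invgK !mulgA.
Qed.

Lemma clt_conj N k x y : 0 < k -> k.+1 < N -> clt N k x y ->
  clt N k.+1 (x * (sigma N k.+1)^-1) (y * (sigma N k.+1)^-1).
Proof.
by move=> k0 kN /(pos_conj k0 kN); rewrite /clt invgM invgK !mulgA.
Qed.

(** The last factor lies in B_m, so modulo B_m only the coset of x sigma_m^-1 matters. *)
Lemma delta_conjE N m (x : braid N) : 0 < m ->
  delta_conj m.+1 x = D N 1 m.+1 * (x * (sigma N m)^-1) * (D N 1 m)^-1.
Proof. by move=> m0; rewrite /delta_conj [in X in _ * X]delta_seg_recr // invgM !mulgA. Qed.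

Lemma cle_delta_conj N m x y : 0 < m -> cle N m (x * (sigma N m)^-1) (y * (sigma N m)^-1) ->
  cle N m (delta_conj m.+1 x) (delta_conj m.+1 y).
Proof.
move=> m0 h; rewrite !delta_conjE //; apply: cle_trans (cle_mulr _ _); last first.
  by apply/nonneg_parabolic/parabolicV/parabolic_delta_seg.
apply: cle_trans (cle_mul2l _ h); apply: cle_parabolicr.
by apply/parabolicV/parabolic_delta_seg.
Qed.

Lemma clt_delta_conj N m x y : 0 < m -> clt N m (x * (sigma N m)^-1) (y * (sigma N m)^-1) ->
  clt N m (delta_conj m.+1 x) (delta_conj m.+1 y).
Proof.
move=> m0 h; rewrite !delta_conjE //; apply: clt_cle_trans (cle_mulr _ _); last first.
  by apply/nonneg_parabolic/parabolicV/parabolic_delta_seg.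
apply: cle_clt_trans (clt_mul2l _ h); apply: cle_parabolicr.
by apply/parabolicV/parabolic_delta_seg.
Qed.

(* Conjugation by delta turns sigma_m^-1 into the base coset. *)
Lemma cle_sigmaV_dual N m x : 0 < m -> m < N -> dual N m.+1 x ->
  cle N m (sigma N m)^-1 (x * (sigma N m)^-1).
Proof.
move=> m0 mN hx; rewrite /cle invgK mulgA.
have -> : sigma N m * x * (sigma N m)^-1 = (D N 1 m)^-1 * delta_conj m.+1 x * D N 1 m.
  by rewrite delta_conjE // !mulgA mulgVK delta_seg_recr // mulKg.
apply: nonnegM; last by apply/nonneg_parabolic/parabolic_delta_seg.
apply: nonnegM; first by apply/nonneg_parabolic/parabolicV/parabolic_delta_seg.
by apply: dual_nonneg; apply: dual_delta_conj.
Qed.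

Lemma clt_braid_lt N k x y : 0 < k < N -> clt N k x y -> braid_lt x y.
Proof. by move=> hk h; apply/sigma_positiveP; exists k. Qed.

Lemma braid_lt_mul2l N (z x y : braid N) : braid_lt x y -> braid_lt (z * x) (z * y).
Proof. by rewrite /braid_lt invgM !mulgA mulgVK. Qed.

(** * Last letters of tail-free braids, splittings as lists, and their comparison *)

Lemma notail_last N m x : dual N m x -> x <> 1 -> notail N m x ->
  exists p y, [/\ 0 < p < m, dual N m y & x = y * band N p m].
Proof.
move=> /dualP [w hw ->] x1 nt; case/lastP: w hw x1 nt => [|w [p s]].
  by rewrite band_word_nil.
rewrite all_rcons band_word_rcons /= => /andP[/and3P[/= p0 ps]].
rewrite leq_eqVlt => /orP[/eqP e|sm] hw _ nt.
  by subst s; exists p, (band_word N w); split; rewrite ?p0 //; apply: dual_band_word.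
by case: (nt (band_word N w) p s) => //; apply: dual_band_word.
Qed.

(* [merge_split n s] is phi^(b-1)(s_b) ... phi(s_2) s_1 for s = [:: s_1; ...; s_b], where
   phi is conjugation by delta_n: sequences are written here from s_1 to s_b. *)
Definition merge_split N n (s : seq (braid N)) : braid N :=
  foldr (fun v x => delta_conj n x * v) 1 s.

(** The empty list stands for the trivial braid, and the last element of the list is the top entry,
    which must be nontrivial. The lowest entry of a full splitting is kept outside, so the splitting
    (1) becomes the entry 1 over the empty list. *)
Fixpoint split_seq N m (s : seq (braid N)) : Prop :=
  if s is v :: t then
    [/\ dual N m v, split_seq m t, notail N m.+1 (delta_conj m.+1 (merge_split m.+1 t)) &
        t = [::] -> v <> 1]
  else True.

(** ShortLex for lists written from the lowest entry: comparing the tails first gives priority to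
    the length, then to the highest differing entry. *)
Fixpoint lex_lt N (s t : seq (braid N)) : Prop :=
  match s, t with
  | _, [::] => False
  | [::], _ :: _ => True
  | u :: s', v :: t' => lex_lt s' t' \/ (s' = t' /\ braid_lt u v)
  end.

(* [reach m s z] makes the strict inequality between the cosets of [z * sigma_m^-1]
   and [merge_split s * sigma_m^-1] quantitative, with enough room to absorb the
   lower entries of longer sequences. *)
Definition reach N m (s : seq (braid N)) (z : braid N) : Prop :=
  if s is v :: t then
    let y := delta_conj m.+1 (merge_split m.+1 t) in
    (v = 1 /\ clt N m (z * (sigma N m)^-1) (y * (sigma N m)^-1)) \/
    exists p v' e, [/\ 0 < p < m, dual N m v', v = v' * band N p m, parabolic N p.+1 m e &
      cle N m (z * (sigma N m)^-1) (y * v' * e * (sigma N m)^-1)]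
  else False.

(** The strengthened induction hypothesis: a strict inequality between tail-free braids leaves a
    threshold below the larger one, as a bare inequality need not survive the lower entries. *)
Definition lt_room N m : Prop := forall x y : braid N,
  dual N m x -> dual N m y -> notail N m x -> notail N m y -> braid_lt x y ->
  exists p y' e, [/\ 0 < p < m, dual N m y', y = y' * band N p m, parabolic N p.+1 m e &
    cle N m.-1 x (y' * e)].

Definition lt_comparable N m : Prop := forall x y : braid N,
  dual N m x -> dual N m y -> [\/ x = y, braid_lt x y | braid_lt y x].

(** This puts the threshold v' e strictly below the entry v' a_(p,k+1). *)
Lemma parabolic_clt_band N k p e : 0 < p -> p <= k -> k < N -> parabolic N p.+1 k.+1 e ->
  clt N k e (band N p k.+1).
Proof.
move=> p0 pk kN he; rewrite /clt bandE //= mulgA.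
have [y hy /intertwinesV ->] := parabolic_shift p0 kN he.
rewrite delta_seg_recr //; apply: posMr; last by apply/nonneg_parabolic/parabolicV/parabolic_delta_seg.
apply: posMr; last by apply/nonneg_parabolic/parabolicV; apply: parabolicS hy.
by apply: posMl (pos_sigma _ _); apply/nonneg_parabolic/parabolic_delta_seg.
Qed.

Lemma reach_lt N k s z : 0 < k -> k.+1 < N -> reach k.+1 s z ->
  clt N k.+1 (z * (sigma N k.+1)^-1) (merge_split k.+2 s * (sigma N k.+1)^-1).
Proof.
move=> k0 kN; case: s => //= v t [[-> h]|[p [v' [e [/andP[p0 pk] hv' -> he h]]]]].
  by rewrite mulg1.
apply: cle_clt_trans h _; rewrite [_ * (v' * _)]mulgA -!(mulgA (_ * v')).
apply: clt_mul2l; apply: clt_conj => //.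
by apply: parabolic_clt_band => //; lia.
Qed.

Lemma dual_merge_split N m s : m.+1 <= N -> split_seq m s -> dual N m.+1 (merge_split m.+1 s).
Proof.
move=> mN; elim: s => [_|v t IH /= [hv ht _ _]]; first exact: dual_one.
by apply: dual_mul; [apply: dual_delta_conj => //; apply: IH|apply: dualS hv].
Qed.

Lemma merge_split_neq1 N m (s : seq (braid N)) : m.+1 <= N -> split_seq m s -> s <> [::] ->
  merge_split m.+1 s <> 1.
Proof.
move=> mN hs s0 e; have : braid_len (merge_split m.+1 s) = 0%R by rewrite e braid_len1.
move: hs s0 {e}; elim: s => //= v t IH [hv ht _ v1] _.
rewrite braid_lenM braid_len_delta_conj.
have [a ea a1] := dual_len mN (dual_merge_split mN ht).
have [b eb b1] := dual_len (ltnW mN) hv.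
rewrite ea eb => ab; have a0 : a = 0%N by lia.
have b0 : b = 0%N by lia.
case: t IH ht v1 ea {a1} => [|w t] IH ht v1 ea; first by case: (v1 erefl); apply: b1.
by apply: IH => //; rewrite ea a0.
Qed.

Lemma delta_conj_neq1 N n (x : braid N) : x <> 1 -> delta_conj n x <> 1.
Proof. by move=> x1 e; apply: x1; apply: (@delta_conj_inj N n); rewrite e delta_conj1. Qed.

Lemma notail_delta_conj_sub N n x y p q : n <= N -> dual N n x -> 0 < p -> p < q ->
  notail N n (delta_conj n y) -> y = x * band N p q -> q = n.-1 \/ q = n \/ n < q.
Proof.
move=> nN hx p0 pq nt e.
have [qn|] := ltnP q n.-1; last by lia.
case: (nt (delta_conj n x) p.+1 q.+1) => //; [exact: dual_delta_conj|lia|].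
by rewrite e delta_conjM delta_conj_band //; lia.
Qed.

(** Conjugation by delta turns a_(p,n) into a_(1,p+1), a letter below n as soon as p < n - 1. *)
Lemma notail_delta_conj_top N n x y p : n <= N -> dual N n x -> 0 < p -> p < n.-1 ->
  notail N n (delta_conj n y) -> y <> x * band N p n.
Proof.
move=> nN hx p0 pn nt e.
case: (nt (delta_conj n x) 1%N p.+1) => //; [exact: dual_delta_conj|lia|].
by rewrite e delta_conjM delta_conj_band_top //; lia.
Qed.

Lemma notail_head N m v t : m < N -> split_seq m (v :: t) ->
  notail N m.+1 (delta_conj m.+1 (merge_split m.+1 (v :: t))) -> notail N m v.
Proof.
move=> mN [hv ht _ _] nt y r s hy r0 rs sm e.
have hd : dual N m.+1 (delta_conj m.+1 (merge_split m.+1 t) * y).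
  apply: dual_mul; last exact: dualS hy.
  by apply: dual_delta_conj => //; apply: dual_merge_split.
have := @notail_delta_conj_sub N m.+1 _ _ r s mN hd r0 rs nt.
by rewrite /= e mulgA => /(_ erefl); lia.
Qed.

(** The part above the entry 1 ends in some a_(p,m+1) by its own tail condition. As no entry
    intervenes, p < m is excluded by the next conjugation. *)
Lemma one_head N m t : 1 < m -> m < N -> split_seq m (1 :: t) ->
  notail N m.+1 (delta_conj m.+1 (merge_split m.+1 (1 :: t))) ->
  exists2 y, dual N m.+1 y & delta_conj m.+1 (merge_split m.+1 t) = y * band N m m.+1.
Proof.
move=> m1 mN [_ ht nt h1] nt'; have t0 : t <> [::] by move/h1.
have hd : dual N m.+1 (delta_conj m.+1 (merge_split m.+1 t)).
  by apply: dual_delta_conj => //; apply: dual_merge_split.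
have n1 : delta_conj m.+1 (merge_split m.+1 t) <> 1.
  by apply/delta_conj_neq1/merge_split_neq1.
have [p [y [/andP[p0 pm] hy e]]] := notail_last hd n1 nt.
have : p <= m by lia.
rewrite leq_eqVlt => /orP[/eqP epm|pm']; first by subst p; exists y.
case: (@notail_delta_conj_top N m.+1 y _ p _ hy p0 pm' nt') => //.
by rewrite /= mulg1.
Qed.

(** The entry 1 leaves a_(m,m+1) on its left, which the conjugation turns into a_(1,m+1). No letter
    of v crosses this chord, so it passes to the right of v and becomes a_(1,2) at the next
    conjugation. *)
Lemma inner_head_neq1 N m v t : 1 < m -> m < N -> split_seq m (v :: 1 :: t) ->
  ~ notail N m.+1 (delta_conj m.+1 (merge_split m.+1 (v :: 1 :: t))).
Proof.
move=> m1 mN [hv ht nt _] nt'.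
have [y hy e] := one_head m1 mN ht nt.
have e1 : delta_conj m.+1 (merge_split m.+1 (1 :: t)) = delta_conj m.+1 y * band N 1 m.+1.
  by rewrite /= mulg1 e delta_conjM delta_conj_band_top //; lia.
have [z hz ez] : exists2 z, dual N m.+1 z & band N 1 m.+1 * v = z * band N 1 m.+1.
  case/dualP: hv => w hw ->; elim: w hw => [_|[r s] w IH /= /andP[/and3P[/= r0 rs sm] hw]].
    by exists 1; [apply: dual_one|rewrite band_word_nil mulg1 mul1g].
  have nbar : ~~ (r < 1 <= s) by lia.
  have [y1 hy1 e2] := @band_top_past N m 1%N r s isT r0 rs sm mN nbar (ltnW m1).
  have [y2 hy2 e3] := IH hw.
  exists (y1 * y2); first exact: dual_mul.
  by rewrite band_word_cons mulgA e2 -mulgA e3 mulgA.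
apply: (@notail_delta_conj_top N m.+1 (delta_conj m.+1 y * z) _ 1%N mN _ isT m1 nt').
  by apply: dual_mul => //; apply: dual_delta_conj.
by rewrite [merge_split _ _]/= -/(merge_split m.+1 (1 :: t)) e1 -mulgA ez mulgA.
Qed.

(** Induction on the larger list. An empty smaller list gives the base coset, equal upper entries
    reduce to [lt_room], and otherwise the threshold found higher up is rotated by delta and pushed
    through the next entry. *)
Lemma lex_reach N k s1 s2 : 0 < k -> k.+1 < N -> lt_room N k.+1 ->
  split_seq k.+1 s1 -> split_seq k.+1 s2 ->
  notail N k.+2 (delta_conj k.+2 (merge_split k.+2 s1)) ->
  notail N k.+2 (delta_conj k.+2 (merge_split k.+2 s2)) ->
  lex_lt s1 s2 -> reach k.+1 s2 (merge_split k.+2 s1).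
Proof.
move=> k0 kN hroom; elim: s2 s1 => [[]//|v2 t2 IH] s1 g1 g2 n1 n2 hlex.
have [hv2 gt2 nt2 _] := g2.
have nv2 := notail_head kN g2 n2.
have dt2 : dual N k.+2 (delta_conj k.+2 (merge_split k.+2 t2)).
  by apply: dual_delta_conj => //; apply: dual_merge_split.
case: s1 hlex g1 n1 => [_ _ _|v1 t1 hlex g1 n1].
  have [ev2|v21] := EM (v2 = 1).
    left; split => //; have [y hy ->] : exists2 y, dual N k.+2 y &
        delta_conj k.+2 (merge_split k.+2 t2) = y * band N k.+1 k.+2.
      by apply: one_head => //; rewrite -ev2.
    rewrite /= mul1g band_succ mulgK /clt invgK.
    by apply: posMr (pos_sigma _ _) _; apply: dual_nonneg.
  right; have [p [v' [pk hv' ev']]] := notail_last hv2 v21 nv2.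
  exists p, v', 1; split=> //; first exact: parabolic_one.
  rewrite /= mulg1 mul1g; apply: cle_sigmaV_dual => //.
  by apply: dual_mul => //; apply: dualS hv'.
have nv1 := notail_head kN g1 n1.
have [hv1 gt1 nt1 _] := g1.
case: hlex => [hlex|[e12 hlt]]; last first.
  right; have [p [v' [e [pk hv' ev he h]]]] := hroom _ _ hv1 hv2 nv1 nv2 hlt.
  exists p, v', e; split=> //; rewrite /= e12 -!(mulgA (delta_conj _ _)).
  apply: cle_mul2l; exact: (cle_conj k0 kN h).
case: t2 IH g2 gt2 n2 nt2 nv2 dt2 hlex => [|u t]; first by case: (t1).
move=> IH g2 gt2 n2 nt2 nv2 dt2 hlex.
have u1 : u <> 1.
  by move=> e; rewrite e in g2 n2; apply: (inner_head_neq1 _ kN g2 n2).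
have [[//]|[p [u' [e [/andP[p0 pk] hu' eu he h]]]]] := IH _ gt1 gt2 nt1 nt2 hlex.
have [_ gt _ _] := gt2.
set A := delta_conj k.+2 (delta_conj k.+2 (merge_split k.+2 t) * u').
have hA : dual N k.+2 A.
  apply: dual_delta_conj => //; apply: dual_mul; last exact: dualS hu'.
  by apply: dual_delta_conj => //; apply: dual_merge_split.
have eA : delta_conj k.+2 (merge_split k.+2 (u :: t)) = A * band N p.+1 k.+2.
  by rewrite /= eu mulgA delta_conjM delta_conj_band //; lia.
have he2 : parabolic N p.+2 k.+2 (delta_conj k.+2 e) by apply: delta_conj_parabolic he.
have {h} h : cle N k.+1 (delta_conj k.+2 (merge_split k.+2 t1)) (A * delta_conj k.+2 e).
  by rewrite -delta_conjM; apply: cle_delta_conj.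
(* The entry v1 disappears in the coset, and dropping sigma_(k+1)^-1 is a strict increase. *)
clearbody A; have hs : clt N k.+1 (merge_split k.+2 (v1 :: t1) * (sigma N k.+1)^-1)
    (delta_conj k.+2 (merge_split k.+2 t1)).
  rewrite /clt /=; move: (delta_conj _ _) => x.
  rewrite !invgM invgK -!mulgA mulVg mulg1.
  apply: posMr (pos_sigma _ _) _; apply/nonneg_parabolic/parabolicV; exact: dual_parabolic.
have [ev2|v21] := EM (v2 = 1).
  left; split => //; apply: clt_cle_trans hs _.
  (* With v2 = 1 a smaller p would give a forbidden last letter. For this p the rotated e lives on
     one strand, hence is trivial. *)
  have epk : p.+1 = k.+1.
    have : p.+1 <= k.+1 by lia.
    rewrite leq_eqVlt => /orP[/eqP //|pk'].
    have [] := @notail_delta_conj_top N k.+2 A _ p.+1 kN hA isT pk' n2.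
    by rewrite [merge_split _ (v2 :: _)]/= ev2 mulg1 -eA.
  rewrite eA epk band_succ mulgK.
  by move: h; rewrite (parabolic_trivial _ he2) ?epk // mulg1.
right; set q := p.+1 in eA he2.
have [y hy ey] : exists2 y, parabolic N q k.+1 y & intertwines (D N q k.+2) (delta_conj k.+2 e) y.
  by apply: (@parabolic_shift N q k.+2).
have nr y1 r : dual N k.+2 y1 -> 0 < r <= k -> band N q k.+2 * v2 <> y1 * band N r k.+2.
  move=> hy1 /andP[r0 rk] e1.
  apply: (@notail_delta_conj_top N k.+2 (A * y1) _ r kN _ r0 rk n2); first exact: dual_mul.
  by rewrite [merge_split _ (v2 :: _)]/= -/(merge_split k.+2 (u :: t)) eA -mulgA e1 mulgA.
have hq : q <= k.+1 by rewrite /q; lia.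
(* This braid is chosen so that a_(q,k+2) times it times sigma_(k+1)^-1 is the rotated threshold
   [delta_conj k.+2 e], up to a right factor in the subgroup. *)
have hey : parabolic N q k.+1 (D N q k.+1 * y) by apply: parabolicM => //; apply: parabolic_delta_seg.
have [p' [v' [e' [pk' hv' ev' he' h']]]] :=
  tail_free_lower_bound kN (ltn0Sn _) hq hv2 v21 nv2 nr hey.
exists p', v', e'; split=> //.
apply: cle_trans (cltW hs) _; apply: cle_trans h _.
rewrite -!(mulgA (delta_conj _ _)).
have := cle_mul2l (delta_conj k.+2 (merge_split k.+2 (u :: t))) (cle_conj k0 kN h').
apply: cle_trans; rewrite [X in X * (_ * _)]eA bandE //=.
have -> : A * delta_conj k.+2 e = A * (D N q k.+2 * (D N q k.+1)^-1) *
    (D N q k.+1 * y * (sigma N k.+1)^-1) * (D N q k.+1)^-1.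
  move: ey; rewrite /intertwines; move: (delta_conj _ e) => x ey.
  rewrite -!mulgA; congr (A * _); rewrite mulKg [_ * (y * _)]mulgA -ey -!mulgA.
  by rewrite [D N q k.+2](delta_seg_recr _ hq) -!mulgA mulVKg mulgV mulg1.
by apply: cle_parabolicr; apply/parabolicV/parabolic_delta_seg; lia.
Qed.

(** * Existence of splittings, and the induction on the number of strands *)

(** Letters of the smaller monoid are stripped from the right as long as possible; the exponent sum
    L bounds their number. *)
Lemma tail_decomp N n x : n < N -> dual N n.+1 x ->
  exists y u, [/\ dual N n.+1 y, notail N n.+1 y, dual N n u & x = y * u].
Proof.
move=> nN hx; have [L eL _] := dual_len nN hx.
elim: L x hx eL => [|L IH] x hx eL.
  exists x, 1; split; rewrite ?mulg1 //; last exact: dual_one.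
  move=> y r s hy r0 rs sm e; have [j ej _] := dual_len nN hy.
  by move: eL; rewrite e braid_lenM braid_len_band ?ej; lia.
have [nt|/existsNP[y /existsNP[r /existsNP[s nt]]]] := EM (notail N n.+1 x).
  by exists x, 1; split; rewrite ?mulg1 //; apply: dual_one.
move/not_implyP: nt => [hy /not_implyP[r0 /not_implyP[rs /not_implyP[sm /contrapT e]]]].
have [|z [u [hz nz hu ez]]] := IH y hy.
  by move: eL; rewrite e braid_lenM braid_len_band; lia.
exists z, (u * band N r s); split=> //; last by rewrite mulgA -ez.
by apply: dual_mul => //; apply: dual_band.
Qed.

(* At most one entry in a row is trivial, so the length drops in two steps. *)
Lemma split_notail N m x : 1 < m -> m < N -> dual N m.+1 x -> notail N m.+1 x ->
  exists2 s, split_seq m s & x = delta_conj m.+1 (merge_split m.+1 s).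
Proof.
move=> m1 mN hx nx; have [L0 eL _] := dual_len mN hx.
have {eL} : (braid_len x < (L0.+1)%:Z)%R by lia.
move: L0.+1 => L; elim: L x hx nx => [|L IH] x hx nx hL.
  by have [j] := dual_len mN hx; lia.
have [x1|x1] := EM (x = 1); first by exists [::] => //=; rewrite x1 delta_conj1.
have unrot y : dual N m.+1 y -> exists z u,
    [/\ dual N m.+1 z, notail N m.+1 z, dual N m u & y = delta_conj m.+1 (z * u)].
  move=> hy; have [z hz <-] := dual_delta_conjP mN hy.
  by have [z' [u [? ? ? ->]]] := tail_decomp mN hz; exists z', u.
have shorter y u : dual N m.+1 y -> dual N m u -> u <> 1 ->
    (braid_len (y * u)%g <= braid_len x)%R -> (braid_len y < L%:Z)%R.
  move=> hy hu u1; rewrite braid_lenM; have [j -> j1] := dual_len (ltnW mN) hu.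
  by case: j j1 => [/(_ erefl)//|j _]; lia.
have [y [u [hy ny hu ex]]] := unrot x hx.
have [u1|u1] := EM (u = 1); last first.
  have lu : (braid_len y < L%:Z)%R.
    by apply: (shorter y u) => //; rewrite ex braid_len_delta_conj.
  have [s gs ys] := IH y hy ny lu; exists (u :: s); last by rewrite /= -ys.
  by split; rewrite -?ys.
rewrite {u hu}u1 mulg1 in ex.
have y1 : y <> 1 by move=> e; apply: x1; rewrite ex e delta_conj1.
have [z [v [hz nz hv ey]]] := unrot y hy.
have step t t' : dual N m.+1 t -> t <> 1 -> notail N m.+1 t -> t' = delta_conj m.+1 t ->
    notail N m.+1 t' -> exists2 w, dual N m.+1 w & t' = w * band N 1 m.+1.
  move=> ht t1 nt et' nt'; have [p [w [/andP[p0 pm] hw et]]] := notail_last ht t1 nt.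
  rewrite et' in nt'; have : p <= m by lia.
  rewrite leq_eqVlt => /orP[/eqP epm|pm']; last first.
    by case: (@notail_delta_conj_top N m.+1 w _ p mN hw p0 pm' nt').
  exists (delta_conj m.+1 w); first exact: dual_delta_conj.
  by rewrite et' et delta_conjM epm delta_conj_band_top //; lia.
(* If v were trivial too, [step] would make y end in a_(1,m+1), which the conjugation giving x turns
   into a_(1,2), against [nx]. *)
have v1 : v <> 1.
  move=> v1; rewrite {v hv}v1 mulg1 in ey.
  have z1 : z <> 1 by move=> e; apply: y1; rewrite ey e delta_conj1.
  have [w hw ew] := step z y hz z1 nz ey ny.
  rewrite ex in nx; apply: (@notail_delta_conj_top N m.+1 w _ 1%N mN hw _ _ nx ew) => //.
have lv : (braid_len z < L%:Z)%R.
  by apply: (shorter z v) => //; rewrite ex braid_len_delta_conj ey braid_len_delta_conj.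
have [s gs zs] := IH z hz nz lv; exists [:: 1, v & s]; last by rewrite /= -zs mulg1 -ey.
split=> //=; rewrite -?zs -?ey //; first exact: dual_one.
Qed.

Lemma lex_lt_total N m (s t : seq (braid N)) : lt_comparable N m -> split_seq m s -> split_seq m t ->
  [\/ s = t, lex_lt s t | lex_lt t s].
Proof.
move=> cmp; elim: s t => [|u s IH] [|v t] /=; [by constructor 1|by constructor 2|by constructor 3|].
move=> [hu gs _ _] [hv gt _ _]; case: (IH t gs gt) => [->|h|h].
- case: (cmp u v hu hv) => [->|h|h]; [by constructor 1|constructor 2|constructor 3]; by right.
- by constructor 2; left.
- by constructor 3; left.
Qed.

Lemma lex_clt N k s t : 0 < k -> k.+1 < N -> lt_room N k.+1 ->
  split_seq k.+1 s -> split_seq k.+1 t ->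
  notail N k.+2 (delta_conj k.+2 (merge_split k.+2 s)) ->
  notail N k.+2 (delta_conj k.+2 (merge_split k.+2 t)) -> lex_lt s t ->
  clt N k.+1 (delta_conj k.+2 (merge_split k.+2 s)) (delta_conj k.+2 (merge_split k.+2 t)).
Proof.
move=> k0 kN hr gs gt ns nt hst; apply: clt_delta_conj => //.
by apply: reach_lt => //; apply: lex_reach.
Qed.

(** The lowest entries lie in B_(k+1), so they are invisible to the cosets when the upper parts
    differ. Otherwise the common left factor cancels. *)
Lemma lex_braid_lt N k s t u v : 0 < k -> k.+1 < N -> lt_room N k.+1 ->
  split_seq k.+1 s -> split_seq k.+1 t -> dual N k.+1 u -> dual N k.+1 v ->
  notail N k.+2 (delta_conj k.+2 (merge_split k.+2 s)) ->
  notail N k.+2 (delta_conj k.+2 (merge_split k.+2 t)) ->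
  lex_lt (u :: s) (v :: t) ->
  braid_lt (merge_split k.+2 (u :: s)) (merge_split k.+2 (v :: t)).
Proof.
move=> k0 kN hr gs gt hu hv ns nt /= [hst|[-> huv]]; last exact: braid_lt_mul2l.
apply: (@clt_braid_lt _ k.+1); first by lia.
apply: clt_cle_trans (cle_mulr _ _); last exact/nonneg_parabolic/dual_parabolic.
by apply: cle_clt_trans (lex_clt k0 kN hr gs gt ns nt hst); apply/cle_parabolicr/dual_parabolic.
Qed.

Lemma split_dual N m x : 1 < m -> m < N -> dual N m.+1 x ->
  exists u s, [/\ dual N m u, split_seq m s, notail N m.+1 (delta_conj m.+1 (merge_split m.+1 s)) &
    x = merge_split m.+1 (u :: s)].
Proof.
move=> m1 mN hx; have [y [u [hy ny hu ->]]] := tail_decomp mN hx.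
have [s gs es] := split_notail m1 mN hy ny.
by exists u, s; split; rewrite -?es //= -es.
Qed.

Lemma lt_comparable_step N k : 0 < k -> k.+1 < N -> lt_room N k.+1 -> lt_comparable N k.+1 ->
  lt_comparable N k.+2.
Proof.
move=> k0 kN hr cmp x y hx hy.
have [u [s [hu gs ns ->]]] := @split_dual N k.+1 x k0 kN hx.
have [v [t [hv gt nt ->]]] := @split_dual N k.+1 y k0 kN hy.
have lst : lex_lt (u :: s) (v :: t) -> [\/ merge_split k.+2 (u :: s) = merge_split k.+2 (v :: t),
    braid_lt (merge_split k.+2 (u :: s)) (merge_split k.+2 (v :: t)) |
    braid_lt (merge_split k.+2 (v :: t)) (merge_split k.+2 (u :: s))].
  by move=> h; constructor 2; apply: lex_braid_lt.
have lts : lex_lt (v :: t) (u :: s) -> [\/ merge_split k.+2 (u :: s) = merge_split k.+2 (v :: t),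
    braid_lt (merge_split k.+2 (u :: s)) (merge_split k.+2 (v :: t)) |
    braid_lt (merge_split k.+2 (v :: t)) (merge_split k.+2 (u :: s))].
  by move=> h; constructor 3; apply: lex_braid_lt.
case: (lex_lt_total cmp gs gt) => [est|h|h]; [|by apply: lst; left|by apply: lts; left].
subst t; case: (cmp u v hu hv) => [->|h|h]; first by constructor 1.
  by apply: lst; right.
by apply: lts; right.
Qed.

(** The threshold of [lex_reach], rotated by delta, is the required one. Only a trivial lowest entry
    of y gives none; then y ends in a_(1,k+2), and e may use all strands from 2 on. *)
Lemma lt_room_step N k : 0 < k -> k.+1 < N -> lt_room N k.+1 -> lt_comparable N k.+1 ->
  lt_room N k.+2.
Proof.
move=> k0 kN hr cmp x y hx hy nx ny hlt.
have [s gs es] := @split_notail N k.+1 x k0 kN hx nx.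
have [t gt et] := @split_notail N k.+1 y k0 kN hy ny.
have ns := nx; have nt := ny; rewrite es in ns; rewrite et in nt.
have hst : lex_lt s t.
  case: (lex_lt_total cmp gs gt) => // [est|h]; first by case: (@braid_lt_irr _ x); rewrite {2}es est -et.
  case: (@braid_lt_irr _ x); apply: braid_lt_trans hlt _.
  by apply: (@clt_braid_lt _ k.+1); [lia|rewrite es et; apply: lex_clt].
have := lex_reach k0 kN hr gs gt ns nt hst; case: t gt et nt hst => // v t gt et nt hst.
have [hv gt' _ _] := gt.
have dt : dual N k.+2 (delta_conj k.+2 (merge_split k.+2 t)).
  by apply: dual_delta_conj => //; apply: dual_merge_split.
case=> [[v1 _]|[p [v' [e [/andP[p0 pk] hv' ev he h]]]]].
  have {}v1 := v1; subst v.
  have [z hz ez] := @one_head N k.+1 t k0 kN gt nt.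
  have ey : y = delta_conj k.+2 z * band N 1 k.+2.
    by rewrite et /= mulg1 ez delta_conjM delta_conj_band_top.
  have : clt N k.+1 x y by rewrite es et; apply: lex_clt.
  (* Here b is what follows the last sigma_(k+1) in x^-1 y. Below, e is chosen so that y' e and y
     b^-1 sigma_(k+1)^-1 = x a have the same coset. *)
  case/pos_last => a [b [ha hb eab]].
  have hb' : parabolic N 1 k.+1 ((D N 1 k.+1)^-1 * b^-1).
    by apply: parabolicM; [apply/parabolicV/parabolic_delta_seg|apply: parabolicV].
  have [e he ee] := @parabolic_unshift N 1 k.+2 _ isT kN hb'.
  exists 1%N, (delta_conj k.+2 z), e; split=> //; first exact: dual_delta_conj.
  have ez' : delta_conj k.+2 z * e * D N 1 k.+1 = y * b^-1 * (sigma N k.+1)^-1.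
    rewrite ey bandE //=; apply: (mulIg (sigma N k.+1)); rewrite mulgVK.
    rewrite -[LHS]mulgA -delta_seg_recr // -[LHS]mulgA ee; move: (delta_conj _ _) => c.
    by rewrite !mulgA.
  apply: (@cle_trans _ _ (delta_conj k.+2 z * e * D N 1 k.+1)); last first.
    by apply/cle_parabolicr/parabolic_delta_seg.
  rewrite ez' /cle /= !mulgA eab mulgK mulgK; exact: ha.
exists p.+1, (delta_conj k.+2 (delta_conj k.+2 (merge_split k.+2 t) * v')), (delta_conj k.+2 e); split.
- by lia.
- by apply: dual_delta_conj => //; apply: dual_mul => //; apply: dualS hv'.
- by rewrite et /= ev (mulgA (delta_conj _ _)) [LHS]delta_conjM delta_conj_band //; lia.
- by apply: delta_conj_parabolic he.
- by rewrite es -delta_conjM; apply: cle_delta_conj.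
Qed.

(** * The case of two strands, and the end of the induction *)

Lemma dual2 N x : dual N 2 x -> exists i, x = sigma N 1 ^+ i.
Proof.
elim=> [|p q p0 pq q2|y z _ [i ->] _ [j ->]]; first by exists 0%N.
  have [-> ->] : p = 1%N /\ q = 2 by lia.
  by exists 1%N; rewrite band_succ expg1.
by exists (i + j)%N; rewrite expgnDr.
Qed.

Lemma braid_lt_exp N i j : 1 < N -> i < j -> braid_lt (sigma N 1 ^+ i) (sigma N 1 ^+ j).
Proof.
move=> N1 ij; apply: (@clt_braid_lt _ 1); first by lia.
rewrite -(subnKC ij) expgnDr expgSr -mulgA; apply: clt_mulr.
apply: posMr (pos_sigma _ _) _; elim: (_ - _)%N => [|a IH]; first exact: nonneg1.
by rewrite expgS; apply: nonnegM => //; apply: nonneg_sigma.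
Qed.

Lemma lt_comparable2 N : 1 < N -> lt_comparable N 2.
Proof.
move=> N1 x y /dual2[i ->] /dual2[j ->]; have [ij|ji|->] := ltngtP i j.
- by constructor 2; apply: braid_lt_exp.
- by constructor 3; apply: braid_lt_exp.
- by constructor 1.
Qed.

Lemma lt_room2 N : 1 < N -> lt_room N 2.
Proof.
move=> N1 x y /dual2[i ->] /dual2[j ->] _ _ hlt.
have ij : i < j.
  rewrite ltnNge; apply/negP; rewrite leq_eqVlt => /orP[/eqP e|ji].
    by rewrite e in hlt; apply: braid_lt_irr hlt.
  exact: braid_lt_irr (braid_lt_trans hlt (braid_lt_exp N1 ji)).
case: j ij {hlt} => // j ij; exists 1%N, (sigma N 1 ^+ j), 1; split=> //.
- elim: j {ij} => [|j IH]; first exact: dual_one.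
  by rewrite expgS -band_succ; apply: dual_mul; [apply: dual_band|rewrite band_succ].
- by rewrite band_succ -expgSr.
- exact: parabolic_one.
- move: ij; rewrite mulg1 ltnS leq_eqVlt => /orP[/eqP ->|ij]; first exact: cle_refl.
  rewrite -(subnKC (ltnW ij)) expgnDr; apply: cle_mulr.
  elim: (_ - _)%N => [|a IH]; first exact: nonneg1.
  by rewrite expgS; apply: nonnegM => //; apply: nonneg_sigma.
Qed.

Lemma lt_room_comparable N k : k.+1 < N -> lt_room N k.+2 /\ lt_comparable N k.+2.
Proof.
elim: k => [N1|k IH kN]; first by split; [apply: lt_room2|apply: lt_comparable2].
have [hr hc] := IH (ltnW kN).
by split; [apply: lt_room_step|apply: lt_comparable_step].
Qed.

(** * Translation of splittings and of ShortLex into lists, and the theorem *)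

Lemma notail1 N m : m <= N -> notail N m 1.
Proof.
move=> mN y r s hy r0 rs sm e; have [j ej _] := dual_len mN hy.
have : braid_len (y * band N r s) = 0%R by rewrite -e braid_len1.
by rewrite braid_lenM braid_len_band ?ej; lia.
Qed.

Lemma is_tail_notail n (x : braid n) : is_tail x 1 -> notail n n x.
Proof.
case=> _ _ ht y r s hy r0 rs sm e.
have hb : dual n n.-1 (band n r s) by apply: dual_band; lia.
have [|z hz e1] := ht _ hb; first by exists y.
exact: (@notail1 n n (leqnn n) z r s).
Qed.

Lemma iter_phiM n d (x y : braid n) :
  iter d (@phi n) (x * y) = iter d (@phi n) x * iter d (@phi n) y.
Proof. by elim: d => //= d ->; apply: delta_conjM. Qed.

Lemma entry_rev n (s : seq (braid n)) i : i < size s -> entry s i.+1 = nth 1 (rev s) i.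
Proof. by move=> hi; rewrite /entry nth_rev. Qed.

Lemma prod_merge_split n d (s : seq (braid n)) :
  \prod_(m <- rev (iota 0 (size s))) iter (m + d) (@phi n) (nth 1 s m) =
  iter d (@phi n) (merge_split n s).
Proof.
elim: s d => [|v s IH] d; first by rewrite big_nil; elim: d => //= d <-; rewrite [RHS](delta_conj1 n n).
rewrite /= -cat1s rev_cat big_cat big_seq1 /= -[X in iota X]addn0 iotaDl -map_rev big_map.
have -> : \prod_(j <- rev (iota 0 (size s))) iter (1 + j + d) (@phi n) (nth 1 (v :: s) (1 + j))
  = iter d.+1 (@phi n) (merge_split n s).
  by rewrite -IH; apply: eq_bigr => j _; rewrite addnS addSn.
by rewrite iterSr -iter_phiM.
Qed.

(** The offset d covers both products of the definition: d = 1 gives the exponents of [upper_prod],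
    and d = 0 with k = 0 those of the full product. *)
Lemma prod_entries n d k (s : seq (braid n)) : k <= size s ->
  \prod_(m <- rev (index_iota k.+1 (size s).+1)) iter (m - k.+1 + d) (@phi n) (entry s m) =
  iter d (@phi n) (merge_split n (drop k (rev s))).
Proof.
move=> hk; rewrite -prod_merge_split size_drop size_rev /index_iota subSS.
rewrite -[X in iota X](addn0 k.+1) iotaDl -map_rev big_map.
rewrite !big_seq; apply: eq_bigr => j; rewrite mem_rev mem_iota add0n => hj.
rewrite addKn nth_drop addSn entry_rev //; lia.
Qed.

Lemma upper_prodE n (s : seq (braid n)) k : k <= size s ->
  upper_prod s k = delta_conj n (merge_split n (drop k (rev s))).
Proof.
move=> hk; rewrite -[RHS]/(iter 1 (@phi n) _) -prod_entries // /upper_prod !big_seq.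
apply: eq_bigr => j; rewrite mem_rev mem_index_iota => hj; congr (iter _ _ _); lia.
Qed.

Lemma split_seq_of_entries n m (s : seq (braid n)) : m.+1 = n -> s <> [::] ->
  (forall i, i < size s -> dual n m (nth 1 s i)) ->
  (forall k, 0 < k < size s -> notail n n (delta_conj n (merge_split n (drop k s)))) ->
  last 1 s <> 1 -> split_seq m s.
Proof.
move=> mn; elim: s => //= v t IH _ hd hk hl; case: t IH hd hk hl => [|w t] IH hd hk hl.
  by split=> //=; [apply: (hd 0%N)|rewrite delta_conj1; apply: notail1; rewrite mn].
split=> //; first exact: (hd 0%N).
  apply: IH => // [i hi|k hk']; first exact: (hd i.+1).
  by case/andP: hk' => _ hk'; apply: (hk k.+1).
by rewrite mn; exact: (hk 1%N isT).
Qed.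

Lemma split_seq_of_splitting n m (x : braid n) s : m.+1 = n -> is_splitting x s ->
  exists u t, [/\ rev s = u :: t, dual n m u, split_seq m t,
    notail n m.+1 (delta_conj m.+1 (merge_split m.+1 t)) & x = merge_split m.+1 (u :: t)].
Proof.
move=> mn; case=> [[-> ->]|[_ s0 hd hl [ex ht]]].
  exists 1, [::]; split=> //=; first exact: dual_one.
    by rewrite delta_conj1; apply: notail1; rewrite mn.
  by rewrite delta_conj1 mulg1.
have hsz := size_rev s.
have hg : split_seq m (rev s).
  apply: split_seq_of_entries => //.
  - by move=> e; rewrite -size_rev e in s0.
  - move=> i; rewrite hsz => hi; rewrite -entry_rev //.
    by have -> : m = n.-1 by [rewrite -mn]; apply: (hd i.+1).
  - move=> k; rewrite hsz => hk; rewrite -upper_prodE; last by lia.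
    exact/is_tail_notail/ht.
  - by move: hl; rewrite /entry subnn; case: (s) s0 => //= a r _; rewrite rev_cons last_rcons.
have ex' : x = merge_split n (rev s).
  rewrite ex -[rev s]drop0 -[RHS]/(iter 0 (@phi n) _) -prod_entries //.
  by apply: eq_bigr => j _; rewrite addn0 subn1.
case: (rev s) hsz hg ex' => [hsz _ _|u t _ [hu gt nt _] ->]; first by rewrite -hsz in s0.
by exists u, t; split=> //; rewrite mn.
Qed.

Lemma lex_ltP N (s t : seq (braid N)) : lex_lt s t <->
  (size s < size t \/ (size s = size t /\ exists2 i, i < size s &
    braid_lt (nth 1 s i) (nth 1 t i) /\
    forall j, i < j < size s -> nth 1 s j = nth 1 t j)).
Proof.
elim: s t => [|u s IH] [|v t] /=.
- by split=> // -[//|[_ [i]]].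
- by split=> // _; left.
- by split=> // -[//|[]].
split=> [[/IH[h|[es [i hi [hlt heq]]]]|[<- huv]]|[h|[[es] [[|i] hi [hlt heq]]]]].
- by left.
- right; split; first by rewrite es.
  exists i.+1 => //; split=> // -[|j] //=; exact: heq.
- by right; split=> //; exists 0%N => //; split=> // -[].
- by left; apply/IH; left.
- right; split=> //; apply: (@eq_from_nth _ 1) => // j hj.
  exact: (heq j.+1).
- left; apply/IH; right; split=> //; exists i => //; split=> // j hj.
  exact: (heq j.+1).
Qed.

Lemma ShortLexP n (s t : seq (braid n)) :
  ShortLex (@braid_lt n) s t <-> lex_lt (rev s) (rev t).
Proof.
split=> [h|/lex_ltP]; [apply/lex_ltP; move: h|]; rewrite /ShortLex !size_rev.
  move=> [h|[es [[|r] // hr [hlt heq]]]]; [by left|right; split=> //].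
  exists r => //; split; first by rewrite -!entry_rev -?es.
  by move=> j hj; rewrite -!entry_rev -?es; [apply: heq|lia..].
move=> [h|[es [i hi [hlt heq]]]]; [by left|right; split=> //].
exists i.+1 => //; split; first by rewrite !entry_rev -?es.
by move=> [|j] // hj; rewrite !entry_rev -?es; [apply: heq|lia..].
Qed.

Theorem theorem1 (n : nat) (beta gamma : braid n) (bs cs : seq (braid n)) :
  2 < n ->
  dual n n beta -> dual n n gamma ->
  is_splitting beta bs -> is_splitting gamma cs ->
  braid_lt beta gamma <-> ShortLex (@braid_lt n) bs cs.
Proof.
case: n beta gamma bs cs => [|[|[|k]]] // beta gamma bs cs _ _ _ hb hc.
have kN : k.+2 < k.+3 by [].
(* The entries lie in B_(n-1)^{+*}, so the induction is used for k + 2 = n - 1 strands inside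
   B_n. *)
have [hr hcmp] := @lt_room_comparable k.+3 k (ltnW kN).
have [u [s [es hu gs ns eb]]] := split_seq_of_splitting (erefl _) hb.
have [v [t [et hv gt nt ec]]] := split_seq_of_splitting (erefl _) hc.
have lst : lex_lt (u :: s) (v :: t) -> braid_lt beta gamma.
  by rewrite eb ec; apply: lex_braid_lt.
have lts : lex_lt (v :: t) (u :: s) -> braid_lt gamma beta.
  by rewrite eb ec; apply: lex_braid_lt.
split=> [hlt|/ShortLexP]; last by rewrite es et.
apply/ShortLexP; rewrite es et.
(* The converse follows from trichotomy of the lists, because < is transitive and irreflexive. *)
have no : ~ lex_lt (v :: t) (u :: s).
  by move=> /lts h; apply: braid_lt_irr (braid_lt_trans hlt h).
case: (lex_lt_total hcmp gs gt) => [est|h|h]; [|by left|by case: no; left].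
subst t; right; split=> //; case: (hcmp u v hu hv) => // [euv|h].
  by subst v; case: (@braid_lt_irr _ beta); rewrite {2}eb -ec.
by case: no; right.
Qed.
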